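(* For every integer $k\geq 0$ there is a veering triangulation $\mathcal{V}_k$ with exactly $8+k$ tetrahedra whose taut polynomial vanishes, i.e. $\Theta_{\mathcal{V}_k}=0$.
   Context: **Ideal triangulations.** Let $M$ be a compact, connected, oriented 3-manifold. An ideal triangulation of $M$ is a decomposition of $M\setminus\partial M$ into finitely many ideal tetrahedra whose triangular faces are identified in pairs by homeomorphisms sending vertices to vertices. Its dual 2-complex (dual spine) $\mathcal{D}$ has a vertex for every tetrahedron, an edge for every face and a 2-cell for every edge of the triangulation. The 1-skeleton of $\mathcal{D}$ is the dual graph $\Gamma$. **Taut triangulations.** A taut structure is a choice of orientations on the edges of $\Gamma$ such that (1) every vertex of $\Gamma$ has two incoming and two outgoing edges; (2) every 2-cell $\sigma$ of $\mathcal{D}$ has exactly one vertex (its bottom vertex) such that the two edges of $\sigma$ adjacent to it both point out of it; (3) every 2-cell $\sigma$ has exactly one vertex (its top vertex) such that the two edges of $\sigma$ adjacent to it both point into it. Dually, the faces of the triangulation are cooriented. The two faces of a tetrahedron $t$ whose coorientations point out of $t$ are its top faces, and their common edge is the top diagonal of $t$. The other two faces are its bottom faces, and their common edge is the bottom diagonal of $t$. The remaining four edges of $t$ are called equatorial. Each face is a bottom face of exactly one tetrahedron, said to be immediately above it. A taut triangulation is an ideal triangulation with a taut structure. **Veering triangulations.** A veering structure on a taut triangulation is a smoothing of the dual spine into a branched surface with prescribed local form around every vertex. Combinatorially: for each face $f$ let its large edge be the bottom diagonal of the tetrahedron immediately above $f$. The taut triangulation is veering if for every tetrahedron $t$ the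 large edges of the two top faces of $t$ are two opposite (disjoint) equatorial edges of $t$. Equivalently (classical definition): the edges can be coloured red and blue so that for every tetrahedron $t$, viewed from above (coorientations pointing towards the viewer), traversing the boundary of each top face of $t$ counterclockwise starting at the top diagonal one meets next a red and then a blue edge, and traversing the boundary of each bottom face of $t$ counterclockwise starting at the bottom diagonal one meets next a blue and then a red edge. **Taut polynomial.** Let $\mathcal{V}$ be a veering triangulation of $M$ with $n$ tetrahedra, set of faces $F$ ($|F|=2n$) and set of edges $E$ ($|E|=n$). Let $H=H_1(M;\mathbb{Z})/\text{torsion}$, written multiplicatively, and let $M^{fab}\to M$ be the cover associated to the kernel of $\pi_1(M)\to H$; its deck group is $H$, and it carries the lifted triangulation $\mathcal{V}^{fab}$. Choosing one lift of each simplex, identify the sets of faces and edges of $\mathcal{V}^{fab}$ with $H\times F$ and $H\times E$ (elements written $h\cdot x$), so that the free abelian groups on them become the free $\mathbb{Z}[H]$-modules $\mathbb{Z}[H]^F$ and $\mathbb{Z}[H]^E$. In each face of $\mathcal{V}^{fab}$ the (stable) branched surface traces a train track with one switch and three half-branches, one for each edge of the face, and the large half-branch meets the large edge. If $1\cdot f$ has large edge $h_0\cdot e_0$ and other two edges $h_1\cdot e_1$, $h_2\cdot e_2$, put $$D(1\cdot f)=h_0\cdot e_0-h_1\cdot e_1-h_2\cdot e_2 .$$ This defines a $\mathbb{Z}[H]$-module homomorphism $D:\mathbb{Z}[H]^F\to\mathbb{Z}[H]^E$, given by an $n\times 2n$ matrix over $\mathbb{Z}[H]$. The taut polynomial $\Theta_{\mathcal{V}}$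 is the greatest common divisor of the maximal ($n\times n$) minors of $D$, well defined up to units $\pm h$, $h\in H$, of $\mathbb{Z}[H]$. *)

(* Defs.v *)
From HB Require Import structures.
From mathcomp Require Import all_boot all_order all_algebra fingroup perm.
From mathcomp Require Import generic_quotient ring_quotient finmap boolp.
From mathcomp.multinomials Require Import monalg.

Set Implicit Arguments.
Unset Strict Implicit.
Unset Printing Implicit Defensive.

Import GRing.Theory.

Local Open Scope ring_scope.
Local Open Scope quotient_scope.

(** * The integral group ring of an abelian group

    [H] is an abelian group in additive notation, so the group element [h],
    seen in [Z[H]], is the generator [<< h >>] and [<< g >> * << h >> =
    << g + h >>].  The library gives [{malg int[K]}] a ring structure only for
    monoids [K] without non-trivial units, whence the alias below. *)

Definition group_ring (H : zmodType) : Type := {malg int[H]}.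

Section GroupRing.
Variable H : zmodType.
Implicit Types (x y z : {malg int[H]}) (h : H).

HB.instance Definition _ :=
  GRing.Zmodule.copy (group_ring H) {malg int[H]}.

Definition gr_elt (h : H) : group_ring H := << h >>.

Definition gr_one : {malg int[H]} := << 0%R >>.

Definition gr_mul x y : {malg int[H]} :=
  \sum_(g <- msupp x) \sum_(h <- msupp y) << x@_g * y@_h *g g + h >>.

Lemma gr_mulw (d1 d2 : {fset H}) x y :
  (msupp x `<=` d1)%fset -> (msupp y `<=` d2)%fset ->
  gr_mul x y = \sum_(g <- d1) \sum_(h <- d2) << x@_g * y@_h *g g + h >>.
Proof.
move=> le_d1 le_d2; rewrite /gr_mul (big_fset_incl _ le_d1) /=.
  apply/eq_bigr=> g _; apply/big_fset_incl => // h _ /mcoeff_outdom ->.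
  by rewrite mulr0 monalgU0.
move=> g _ /mcoeff_outdom xg.
by rewrite big1 // => h _; rewrite xg mul0r monalgU0.
Qed.

Lemma gr_mulC : commutative gr_mul.
Proof.
move=> x y; rewrite /gr_mul exchange_big /=.
by apply/eq_bigr=> h _; apply/eq_bigr=> g _; rewrite mulrC addrC.
Qed.

Lemma gr_mulUl (c : int) h x :
  gr_mul << c *g h >> x = \sum_(k <- msupp x) << c * x@_k *g h + k >>.
Proof.
rewrite (gr_mulw msuppU_le (fsubset_refl _)) big_seq_fset1.
by apply/eq_bigr => k _; rewrite mcoeffUU.
Qed.

Lemma gr_mulUU (c d : int) g h :
  gr_mul << c *g g >> << d *g h >> = << c * d *g g + h >>.
Proof. by rewrite (gr_mulw msuppU_le msuppU_le) !big_seq_fset1 !mcoeffUU. Qed.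

Lemma gr_mul1 : left_id gr_one gr_mul.
Proof.
move=> x; rewrite gr_mulUl [RHS]monalgE.
by apply/eq_bigr=> k _; rewrite mul1r add0r.
Qed.

Lemma gr_mulDl : left_distributive gr_mul +%R.
Proof.
move=> x y z.
rewrite [in RHS](gr_mulw (fsubsetUl _ (msupp y)) (fsubset_refl _)).
rewrite [in RHS](gr_mulw (fsubsetUr (msupp x) _) (fsubset_refl _)).
rewrite (gr_mulw (msuppD_le _ _) (fsubset_refl _)).
rewrite -big_split /=; apply/eq_bigr=> g _.
rewrite -big_split /=; apply/eq_bigr=> h _.
by rewrite mcoeffD mulrDl monalgUD.
Qed.

Lemma gr_mulDr : right_distributive gr_mul +%R.
Proof. by move=> x y z; rewrite !(gr_mulC x) gr_mulDl. Qed.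

Lemma gr_mul0l : left_zero 0 gr_mul.
Proof. by move=> x; rewrite /gr_mul msupp0 big_seq_fset0. Qed.

Lemma gr_mul0r : right_zero 0 gr_mul.
Proof. by move=> x; rewrite gr_mulC gr_mul0l. Qed.

Lemma gr_mulA : associative gr_mul.
Proof.
move=> x y z.
have suml r (F : H -> {malg int[H]}) w :
    gr_mul (\sum_(k <- r) F k) w = \sum_(k <- r) gr_mul (F k) w.
  exact: (big_morph (gr_mul^~ w) (fun _ _ => gr_mulDl _ _ _) (gr_mul0l w)).
have sumr r (F : H -> {malg int[H]}) w :
    gr_mul w (\sum_(k <- r) F k) = \sum_(k <- r) gr_mul w (F k).
  exact: (big_morph (gr_mul w) (fun _ _ => gr_mulDr _ _ _) (gr_mul0r w)).
move: suml sumr gr_mulUU; move: gr_mul => mul suml sumr mulUU.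
rewrite (monalgE x) !suml; apply/eq_bigr=> g _.
rewrite (monalgE y) suml !sumr suml; apply/eq_bigr=> h _.
rewrite (monalgE z) !sumr; apply/eq_bigr=> k _.
by rewrite !mulUU mulrA addrA.
Qed.

Lemma gr_one_neq0 : gr_one != 0.
Proof. by rewrite monalgU_eq0. Qed.

HB.instance Definition _ :=
  GRing.Zmodule_isComNzRing.Build (group_ring H)
    gr_mulA gr_mulC gr_mul1 gr_mulDl gr_one_neq0.

End GroupRing.

(** * Ideal triangulations

    The vertices of every tetrahedron [t : 'I_n] are numbered by ['I_4] and
    [i : 'I_4] also denotes the face of [t] opposite to the vertex [i].  The
    face [i] of [t] is glued to the face [glue t i i] of [nbr t i], its vertex
    [v != i] going to the vertex [glue t i v].  The numbering of the vertices
    orients every tetrahedron; that all gluing permutations are odd says that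
    these orientations fit together, and an oriented triangulation can always be
    numbered in this way.  In an oriented triangulation no edge is glued to
    itself with its ends exchanged, so the gluing yields an oriented 3-manifold
    with boundary once the tetrahedra are truncated at their vertices. *)

Record triangulation (n : nat) := Triangulation {
  nbr : 'I_n -> 'I_4 -> 'I_n;
  glue : 'I_n -> 'I_4 -> {perm 'I_4};
  nbrK : forall t i, nbr (nbr t i) (glue t i i) = t;
  glueK : forall t i, glue (nbr t i) (glue t i i) = ((glue t i)^-1)%g;
  glue_irrefl : forall t i, (nbr t i, glue t i i) != (t, i);
  glue_oriented : forall t i, odd_perm (glue t i);
  triangulation_connected :
    forall t u, connect [rel x y | [exists i, nbr x i == y]] t u
}.

(** A side [(t, i)] is the face [i] of [t]; [mate] is the other side of the
    same face of the triangulation. *)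
Definition mate n (V : triangulation n) (x : 'I_n * 'I_4) : 'I_n * 'I_4 :=
  (nbr V x.1 x.2, glue V x.1 x.2 x.2).

(** A corner [(t, A)], with [#|A| = 2], is the edge of [t] joining the two
    vertices in [A]; it lies on the faces [i \notin A] of [t].  An edge of the
    triangulation is a class of corners under the gluings, and the corners in
    the class are the vertices of the dual 2-cell, each counted as often as the
    boundary of the 2-cell visits it. *)
Definition corner_step n (V : triangulation n) : rel ('I_n * {set 'I_4}) :=
  fun x y => [exists i, (i \notin x.2) &&
                        (y == (nbr V x.1 i, glue V x.1 i @: x.2))].

Definition edge_class n (V : triangulation n) (x : 'I_n * {set 'I_4}) :
    {set 'I_n * {set 'I_4}} := [set y | connect (corner_step V) x y].

Definition edges n (V : triangulation n) : {set {set 'I_n * {set 'I_4}}} :=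
  [set edge_class V x | x in [set x : 'I_n * {set 'I_4} | #|x.2| == 2%N]].

Definition edge n (V : triangulation n) : finType :=
  {e : {set 'I_n * {set 'I_4}} | e \in edges V}.

(** * Taut and veering triangulations

    [out t i] means that the coorientation of the face [i] of [t] (the
    orientation of the dual edge) points out of [t], i.e. that it is a top face
    of [t]. *)

Record taut (n : nat) := Taut {
  taut_tri :> triangulation n;
  out : 'I_n -> 'I_4 -> bool;
  out_mate :
    forall t i, out (nbr taut_tri t i) (glue taut_tri t i i) = ~~ out t i;
  two_out : forall t, #|[set i | out t i]| = 2%N;
  one_bottom : forall e, e \in edges taut_tri ->
    #|[set x in e | [forall i, (i \notin x.2) ==> out x.1 i]]| = 1%N;
  one_top : forall e, e \in edges taut_tri ->
    #|[set x in e | [forall i, (i \notin x.2) ==> ~~ out x.1 i]]| = 1%N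
}.

Section Taut.
Variables (n : nat) (V : taut n).

(** The common edge of two faces consists of the vertices opposite to the two
    other faces. *)
Definition top_diagonal (t : 'I_n) : {set 'I_4} := [set i | ~~ out V t i].
Definition bottom_diagonal (t : 'I_n) : {set 'I_4} := [set i | out V t i].

Definition equatorial (t : 'I_n) (A : {set 'I_4}) : bool :=
  [&& #|A| == 2%N, A != top_diagonal t & A != bottom_diagonal t].

(** The large edge of the face [i] of [t], seen in [t]: the tetrahedron
    immediately above this face is [nbr V t i] if [out V t i], and [t]
    otherwise. *)
Definition large_edge (t : 'I_n) (i : 'I_4) : {set 'I_4} :=
  if out V t i then glue V t i @^-1: bottom_diagonal (nbr V t i)
  else bottom_diagonal t.

Definition is_veering : Prop :=
  forall t i j, out V t i -> out V t j -> i != j ->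
    [/\ equatorial t (large_edge t i), equatorial t (large_edge t j)
      & [disjoint large_edge t i & large_edge t j]].

(** A face is represented by the side on which it is a bottom face. *)
Definition face : finType := {x : 'I_n * 'I_4 | ~~ out V x.1 x.2}.

Definition tet_above (f : face) : 'I_n := (val f).1.
Definition tet_below (f : face) : 'I_n := nbr V (val f).1 (val f).2.

(** * First homology of the dual spine

    The dual edge of the face [f] runs from [tet_below f] to [tet_above f]. *)

Definition chain0 : zmodType := {ffun 'I_n -> int}.
Definition chain1 : zmodType := {ffun face -> int}.

Definition vertex0 (t : 'I_n) : chain0 := [ffun s => (s == t)%:R].

Definition boundary1 (c : chain1) : chain0 :=
  \sum_f (vertex0 (tet_above f) - vertex0 (tet_below f)) *~ (c : {ffun _ -> int}) f.

(** The path in the dual graph from [t] to [nbr V t i] through the face [i]. *)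
Definition step (t : 'I_n) (i : 'I_4) : chain1 :=
  [ffun f => (mate V (t, i) == val f)%:R - ((t, i) == val f)%:R].

(** A flag [(t, i, j)] with [i != j] is a corner, the common edge of the faces
    [i] and [j] of [t], with a direction around it: one leaves [t] through [i]
    and has entered through [j].  The orbit of a flag under [turn] goes once
    around the dual 2-cell. *)
Definition turn (x : 'I_n * 'I_4 * 'I_4) : 'I_n * 'I_4 * 'I_4 :=
  let: (t, i, j) := x in (nbr V t i, glue V t i j, glue V t i i).

Definition cell_boundary (x : 'I_n * 'I_4 * 'I_4) : chain1 :=
  \sum_(y | fconnect turn x y) step y.1.1 y.1.2.

Definition cycle_pred : {pred chain1} := fun c => boundary1 c == 0.

Lemma boundary1_zmod : zmod_morphism boundary1.
Proof.
move=> c d; rewrite /boundary1 -sumrB; apply: eq_bigr => f _.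
by rewrite !ffunE mulrzBr.
Qed.

HB.instance Definition _ :=
  GRing.isZmodMorphism.Build chain1 chain0 boundary1 boundary1_zmod.

Lemma cycle_zmod_closed : zmod_closed cycle_pred.
Proof.
split=> [|c d]; rewrite !unfold_in; first by rewrite raddf0.
by move=> /eqP cz /eqP dz; rewrite raddfB /= cz dz subrr.
Qed.

HB.instance Definition _ :=
  GRing.isZmodClosed.Build chain1 cycle_pred cycle_zmod_closed.

Record cycle1 := Cycle1 { cycle1_val :> chain1; _ : cycle1_val \in cycle_pred }.

HB.instance Definition _ := [isSub for cycle1_val].
HB.instance Definition _ := [Choice of cycle1 by <:].
HB.instance Definition _ := [SubChoice_isSubZmodule of cycle1 by <:].

Definition bounds : {pred cycle1} := fun z =>
  `[< exists c : 'I_n * 'I_4 * 'I_4 -> int,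
        val z = \sum_(x | x.1.2 != x.2) cell_boundary x *~ c x >].

Lemma bounds_zmod_closed : zmod_closed bounds.
Proof.
split=> [|y z]; rewrite !unfold_in.
  apply/asboolP; exists (fun=> 0).
  by rewrite raddf0 big1 // => x _; rewrite mulr0z.
move=> /asboolP[c yc] /asboolP[d zd]; apply/asboolP.
exists (fun x => c x - d x); rewrite raddfB /= yc zd -sumrB.
by apply: eq_bigr => x _; rewrite mulrzBr.
Qed.

HB.instance Definition _ :=
  GRing.isZmodClosed.Build cycle1 bounds bounds_zmod_closed.

Definition H1 : zmodType := Quotient.quot bounds.

Definition torsion : {pred H1} := fun x =>
  `[< exists2 m : nat, (0 < m)%N & x *+ m = 0 >].

Lemma torsion_zmod_closed : zmod_closed torsion.
Proof.
split=> [|x y]; rewrite !unfold_in.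
  by apply/asboolP; exists 1%N.
move=> /asboolP[k k0 xk] /asboolP[m m0 ym]; apply/asboolP.
exists (k * m)%N; first by rewrite muln_gt0 k0.
by rewrite mulrnBl mulrnA xk mul0rn mulnC mulrnA ym mul0rn subrr.
Qed.

HB.instance Definition _ :=
  GRing.isZmodClosed.Build H1 torsion torsion_zmod_closed.

(** [H_1(M; Z)] modulo torsion; the dual spine is a deformation retract of [M]. *)
Definition Hfab : zmodType := Quotient.quot torsion.

Definition homology_class (z : cycle1) : Hfab :=
  \pi_(Quotient.quot torsion) (\pi_(Quotient.quot bounds) z).

Lemma boundary1_step t i :
  boundary1 (step t i) = vertex0 (nbr V t i) - vertex0 t.
Proof.
set d := fun f => vertex0 (tet_above f) - vertex0 (tet_below f).
have mateK (x : 'I_n * 'I_4) : mate V (mate V x) = x.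
  by case: x => u j; rewrite /mate /= nbrK glueK permK.
have single (f0 : face) (b : face -> bool) :
    (forall f, b f = (f == f0)) -> \sum_f d f *~ (b f)%:R = d f0.
  move=> bE; rewrite (bigD1 f0) //= bE eqxx mulr1z big1 ?addr0 // => f.
  by rewrite bE => /negPf->; rewrite mulr0z.
have none (b : face -> bool) :
    (forall f, b f = false) -> \sum_f d f *~ (b f)%:R = 0.
  by move=> bE; rewrite big1 // => f _; rewrite bE mulr0z.
rewrite /boundary1 (eq_bigr (fun f => d f *~ (mate V (t, i) == val f)%:R
                                 - d f *~ ((t, i) == val f)%:R)); last first.
  by move=> f _; rewrite ffunE mulrzBr.
rewrite sumrB; case out_ti: (out V t i).
  have Pf : ~~ out V (mate V (t, i)).1 (mate V (t, i)).2.
    by rewrite out_mate out_ti.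
  pose f0 : face := exist (fun x => ~~ out V x.1 x.2) _ Pf.
  rewrite (single f0) => [|f]; last by rewrite -val_eqE eq_sym.
  rewrite none => [|f]; last first.
    by apply/eqP => tif; have := valP f; rewrite -tif out_ti.
  by rewrite subr0 /d /tet_above /tet_below /= nbrK.
have Pf : ~~ out V (t, i).1 (t, i).2 by rewrite out_ti.
rewrite none => [|f]; last first.
  by apply/eqP => tif; have := valP f; rewrite -tif out_mate out_ti.
pose f0 : face := exist (fun x => ~~ out V x.1 x.2) _ Pf.
rewrite (single f0) => [|f]; last by rewrite -val_eqE eq_sym.
by rewrite sub0r /d /tet_above /tet_below /= opprB.
Qed.
End Taut.

Record veering (n : nat) := Veering {
  veering_taut :> taut n;
  veeringP : is_veering veering_taut
}.

(** * Lifts to the free abelian cover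

    The lift [1 . t] of a tetrahedron [t] is given by the 1-chain [path t]
    carried by a path from the base tetrahedron to [t], namely as the end of
    the lift of this path; only the class of the chain matters. *)

Record tet_lifts (n : nat) (V : taut n) := TetLifts {
  base : 'I_n;
  path : 'I_n -> chain1 V;
  boundary_path :
    forall t, boundary1 (path t) = vertex0 t - vertex0 base
}.

Section Lifts.
Variables (n : nat) (V : taut n) (L : tet_lifts V).

Lemma holonomy_subproof t i :
  path L t + step V t i - path L (nbr V t i) \in @cycle_pred n V.
Proof.
rewrite unfold_in /cycle_pred raddfB raddfD /= !boundary_path boundary1_step.
by rewrite subr_eq0 addrC subrKA.
Qed.

(** The face [i] of [1 . t] is glued to [holonomy t i . nbr V t i]. *)
Definition holonomy (t : 'I_n) (i : 'I_4) : Hfab V :=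
  homology_class (Cycle1 (holonomy_subproof t i)).

End Lifts.

(** The lifts of the faces and edges are recorded by the positions of the sides
    and corners of [1 . t]: its face [i] is [face_lift t i . f], where [f] is the
    face of [V] that it covers, and likewise its edge [A] is
    [edge_lift t A . e].  Such functions, compatible with the gluings, are the
    same as a choice of one lift of every face and every edge. *)
Record lifts (n : nat) (V : taut n) := Lifts {
  lifts_tet :> tet_lifts V;
  face_lift : 'I_n -> 'I_4 -> Hfab V;
  edge_lift : 'I_n -> {set 'I_4} -> Hfab V;
  face_lift_glue : forall t i,
    face_lift t i
    = holonomy lifts_tet t i + face_lift (nbr V t i) (glue V t i i);
  edge_lift_glue : forall t i (A : {set 'I_4}), #|A| = 2%N -> i \notin A ->
    edge_lift t A
    = holonomy lifts_tet t i + edge_lift (nbr V t i) (glue V t i @: A)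
}.

(** * The taut polynomial *)

Section TautPolynomial.
Variables (n : nat) (V : taut n) (L : lifts V).

(** The coefficient of [1 . e] in [D (1 . f)].  If [f] is the bottom face [i] of
    [t], then [1 . f] is the face [i] of [- face_lift t i . t], whose edge [A]
    is [(edge_lift t A - face_lift t i) . e] when the corner [(t, A)] belongs to
    [e].  Several edges of [f] may belong to the same [e]. *)
Definition taut_coef (e : edge V) (f : face V) : group_ring (Hfab V) :=
  let: (t, i) := val f in
  \sum_(A : {set 'I_4} | [&& #|A| == 2%N, i \notin A & (t, A) \in val e])
    (if A == large_edge V t i then 1 else - 1)
      * gr_elt (edge_lift L t A - face_lift L t i).

Definition taut_matrix : 'M[group_ring (Hfab V)]_(#|edge V|, #|face V|) :=
  \matrix_(a, b) taut_coef (enum_val a) (enum_val b).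

(** The maximal minors: there are as many edges as tetrahedra, every edge being
    the top diagonal of exactly one tetrahedron, and twice as many faces. *)
Definition maximal_minor (g : 'I_#|edge V| -> 'I_#|face V|) :
    group_ring (Hfab V) := \det (colsub g taut_matrix).

End TautPolynomial.

Definition increasing (m p : nat) (g : 'I_m -> 'I_p) : Prop :=
  forall a b : 'I_m, (a < b)%N -> (g a < g b)%N.

Definition divides (R : comNzRingType) (d x : R) : Prop :=
  exists q, x = q * d.

(** Gcds in [Z[H]] are defined up to units, so the taut polynomial is a relation;
    another choice of lifts multiplies the rows and columns of the matrix by
    units, hence does not change this relation. *)
Definition is_taut_polynomial (n : nat) (V : veering n)
    (Theta : group_ring (Hfab V)) : Prop :=
  exists L : lifts V,
    (forall g, increasing g -> divides Theta (maximal_minor L g)) /\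
    (forall d, (forall g, increasing g -> divides d (maximal_minor L g)) ->
       divides d Theta).

Arguments is_taut_polynomial {n} V Theta.

(* Main.v *)
From HB Require Import structures.
From mathcomp Require Import all_boot all_order all_algebra.
From mathcomp Require Import fingroup perm.
From mathcomp Require Import generic_quotient ring_quotient boolp zify.

Require Import Defs.
Set Implicit Arguments.
Unset Strict Implicit.
Unset Printing Implicit Defensive.

Import GRing.Theory.

Local Open Scope ring_scope.
Local Open Scope quotient_scope.

(** The triangulation [V_k] is obtained from a triangulation by eight tetrahedra
    by splicing a chain of [k] tetrahedra into one face, that between the
    tetrahedra 2 and 6.

    Veering.  Give every diagonal one of two colours.  The equatorial edges of a
    tetrahedron alternate in colour, and a face has two edges of the colour of
    the diagonal on it, so an orientation preserving identification of a top
    face with a bottom face is determined by the colours once the two diagonals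
    have the same colour, and it makes the large edge of the top face an
    equatorial edge of the colour of the top diagonal.  Hence a bijection from
    top faces to bottom faces that respects colours satisfies the veering
    condition ([gluing_is_veering]).  What remains for tautness is that the fan
    of corners above each top diagonal closes up at one bottom diagonal and that
    these fans contain all corners; a labelling of the corners by edges that is
    invariant under the gluings, together with a height that decreases downwards,
    proves it ([connect_label], [gluing_one_bottom], [gluing_one_top]).

    Vanishing.  The taut polynomial vanishes as soon as a combination of the rows
    of the matrix is zero and one of its coefficients is 1: multiply by the
    adjugate of a maximal minor ([vanishing_taut_polynomial]).  Such a combination
    is an equivariant assignment of weights in [Z[H]] to the edges of the free
    abelian cover for which, in each face, the weight of the large edge is the
    sum of the weights of the two other edges.

    To write weights down one must know enough of [H].  Lifting the tetrahedra
    along a maximal tree of the dual graph, the 2-cells give linear relations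
    between the classes of the remaining dual edges ([fan_relation]).  They say
    that [(2k + 6) a = 0] for one of these classes and express the others by [a]
    and by the class [g] of the dual edge leaving the tetrahedron 4 through its
    second top face; as [H] is torsion-free, [a = 0], and each face has class
    0 or [g] ([tet_hol_crosses]).  With [X] the element [g] of [Z[H]] and edges
    numbered by the tetrahedra that have them as top diagonal, the weights are 0
    on 0 and 7, [X - 1] on 1, [1 - X] on 2 and on the chain, 1 on 3 and 6, and
    -1 on 4 and 5 ([weight_face]). *)

(** * The gluing of two coloured faces *)

(** The vertices of a tetrahedron seen from above are 0, 1, 2, 3 in
    counterclockwise order, the top diagonal being 02 and the bottom diagonal 13.
    So the top faces are those opposite to 1 and 3, the bottom faces those
    opposite to 0 and 2.  Colours are booleans, [true] for red; the edges 01 and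
    23 are red, 12 and 30 blue. *)
Definition tf (s : bool) : 'I_4 := if s then @Ordinal 4 1 isT else @Ordinal 4 3 isT.
Definition bf (s : bool) : 'I_4 := if s then @Ordinal 4 2 isT else @Ordinal 4 0 isT.

Arguments tf : simpl never.
Arguments bf : simpl never.

Variant face_spec : 'I_4 -> Type :=
  | TopFace s : face_spec (tf s)
  | BottomFace s : face_spec (bf s).

Lemma faceP i : face_spec i.
Proof.
case: i => [[|[|[|[|//]]]] lti].
- by rewrite (_ : Ordinal _ = bf false); [constructor | exact: val_inj].
- by rewrite (_ : Ordinal _ = tf true); [constructor | exact: val_inj].
- by rewrite (_ : Ordinal _ = bf true); [constructor | exact: val_inj].
- by rewrite (_ : Ordinal _ = tf false); [constructor | exact: val_inj].
Qed.

Lemma tf_eq s r : (tf s == tf r) = (s == r). Proof. by case: s; case: r. Qed.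
Lemma bf_eq s r : (bf s == bf r) = (s == r). Proof. by case: s; case: r. Qed.
Lemma tf_bf s r : (tf s == bf r) = false. Proof. by case: s; case: r. Qed.
Lemma bf_tf s r : (bf s == tf r) = false. Proof. by case: s; case: r. Qed.

Definition face_eqs := (tf_eq, bf_eq, tf_bf, bf_tf).

Definition is_top (i : 'I_4) : bool := odd i.
Definition side (i : 'I_4) : bool := (i == tf true) || (i == bf true).

Lemma is_top_tf s : is_top (tf s) = true. Proof. by case: s. Qed.
Lemma is_top_bf s : is_top (bf s) = false. Proof. by case: s. Qed.
Lemma side_tf s : side (tf s) = s. Proof. by case: s. Qed.
Lemma side_bf s : side (bf s) = s. Proof. by case: s. Qed.
Definition sideE := (is_top_tf, is_top_bf, side_tf, side_bf).

(** The rotation about the vertical axis, which preserves colours and exchanges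
    the two top faces and the two bottom faces. *)
Definition half_turn : {perm 'I_4} :=
  (tperm (tf true) (tf false) * tperm (bf true) (bf false))%g.

(** The only orientation preserving identification of the top face 012 with the
    bottom face 123 that respects the colours, [c] being that of both diagonals,
    extended by sending the opposite vertex to the opposite vertex.  For red, the
    top diagonal 20, 01 and 12 go to 23, 31 and 12; for blue, 01 goes to 23. *)
Definition base_glue (c : bool) : {perm 'I_4} :=
  if c then tperm (tf false) (bf false)
  else (tperm (bf false) (bf true) * tperm (bf false) (tf true)
        * tperm (bf false) (tf false))%g.

Definition face_glue (c s r : bool) : {perm 'I_4} :=
  (half_turn ^+ s * base_glue c * half_turn ^+ r)%g.

Lemma odd_half_turn : odd_perm half_turn = false.
Proof. by rewrite odd_permM !odd_tperm !face_eqs. Qed.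

Lemma odd_face_glue c s r : odd_perm (face_glue c s r).
Proof.
have odd_X (b : bool) : odd_perm (half_turn ^+ b)%g = false.
  by case: b; rewrite ?expg1 ?expg0 ?odd_half_turn ?odd_perm1.
rewrite !odd_permM !odd_X addbF /base_glue; case: c.
  by rewrite odd_tperm face_eqs.
by rewrite !odd_permM !odd_tperm !face_eqs.
Qed.

(** The values of [face_glue c s r] in closed form, the faces being named by the
    opposite vertices. *)
Definition face_glue_fun (c s r : bool) (i : 'I_4) : 'I_4 :=
  if is_top i then
    if side i == s then bf r else tf (r (+) c)
  else if side i == s then (if c then tf r else bf (~~ r))
       else (if c then bf (~~ r) else tf (~~ r)).

Lemma half_turn_tf s : half_turn (tf s) = tf (~~ s).
Proof. by case: s; rewrite permM !permE /=; apply/val_inj. Qed.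
Lemma half_turn_bf s : half_turn (bf s) = bf (~~ s).
Proof. by case: s; rewrite permM !permE /=; apply/val_inj. Qed.
Lemma half_turnX_tf (b s : bool) : (half_turn ^+ b)%g (tf s) = tf (s (+) b).
Proof. by case: b; rewrite ?expg1 ?expg0 ?half_turn_tf ?perm1 ?addbT ?addbF. Qed.
Lemma half_turnX_bf (b s : bool) : (half_turn ^+ b)%g (bf s) = bf (s (+) b).
Proof. by case: b; rewrite ?expg1 ?expg0 ?half_turn_bf ?perm1 ?addbT ?addbF. Qed.

Lemma base_glueE c i : base_glue c i = face_glue_fun c false false i.
Proof.
case/faceP: i => s; case: c; case: s; rewrite /base_glue ?permM !permE /=;
  by apply: val_inj.
Qed.

Lemma face_glueE c s r i : face_glue c s r i = face_glue_fun c s r i.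
Proof.
rewrite !permM; case/faceP: i => b; rewrite ?half_turnX_tf ?half_turnX_bf base_glueE;
  rewrite /face_glue_fun !sideE; case: c; case: s; case: b => /=;
  by rewrite ?half_turnX_tf ?half_turnX_bf; case: r.
Qed.

(* values *)
Lemma face_glue_tf c s r : face_glue c s r (tf s) = bf r.
Proof. by rewrite face_glueE /face_glue_fun !sideE eqxx. Qed.
Lemma face_glue_tfN c s r : face_glue c s r (tf (~~ s)) = tf (r (+) c).
Proof. by rewrite face_glueE /face_glue_fun !sideE; case: s. Qed.
Lemma face_glue_bf c s r d :
  face_glue c s r (bf (s (+) d)) = if d == c then bf (~~ r) else tf (r (+) d).
Proof. by rewrite face_glueE /face_glue_fun !sideE; case: s; case: d; case: r; case: c. Qed.

(** The corners of a tetrahedron.  [Eq c s] is the equatorial edge of colour [c]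
    on the bottom face [s]; it lies on the top face [s (+) c]. *)
Inductive corner := Top | Bot | Eq of bool & bool.

Definition corner_faces (q : corner) : 'I_4 * 'I_4 :=
  match q with
  | Top => (tf false, tf true)
  | Bot => (bf false, bf true)
  | Eq c s => (tf (s (+) c), bf s)
  end.

Definition corner_set (q : corner) : {set 'I_4} :=
  ~: [set (corner_faces q).1; (corner_faces q).2].

Definition on_face (i : 'I_4) (q : corner) : bool :=
  (i == (corner_faces q).1) || (i == (corner_faces q).2).

Definition set_corner (A : {set 'I_4}) : corner :=
  if (tf false \notin A) && (tf true \notin A) then Top
  else if (bf false \notin A) && (bf true \notin A) then Bot
  else Eq ((tf true \notin A) (+) (bf true \notin A)) (bf true \notin A).

Lemma in_corner_set i q : (i \notin corner_set q) = on_face i q.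
Proof. by rewrite !inE negbK. Qed.

Lemma corner_setK q : set_corner (corner_set q) = q.
Proof.
rewrite /set_corner !in_corner_set /on_face.
by case: q => [||c s] /=; rewrite ?face_eqs //; case: c; case: s.
Qed.

Lemma card_corner_set q : #|corner_set q| = 2%N.
Proof.
apply/eqP; rewrite -(eqn_add2l #|[set (corner_faces q).1; (corner_faces q).2]|).
by rewrite cardsC card_ord cards2; case: q => [||c s] /=; rewrite ?face_eqs.
Qed.

Lemma set_cornerK (A : {set 'I_4}) : #|A| = 2%N -> corner_set (set_corner A) = A.
Proof.
move=> A2; have AC2: #|~: A| = 2%N.
  by apply/eqP; rewrite -(eqn_add2l #|A|) cardsC card_ord A2.
have /eqP/cards2P[i [j [neq_ij defA]]] := AC2.
rewrite -[RHS]setCK defA /corner_set; congr (~: _).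
have notA x : (x \notin A) = (x == i) || (x == j) by rewrite -in_setC defA !inE.
rewrite /set_corner !notA => {notA defA A2 AC2}.
case/faceP: i neq_ij => s; case/faceP: j => r; rewrite ?face_eqs;
  by case: s; case: r => //= _; rewrite 1?setUC.
Qed.

(** The corner above the face that corresponds to the corner [q] below it, when
    [c] is the colour of the diagonals on the face and [r] its number seen from
    above: the top diagonal becomes equatorial, the equatorial edge of colour [c]
    is the large one and becomes the bottom diagonal, and the third edge stays
    equatorial. *)
Definition up_corner (c r : bool) (q : corner) : corner :=
  match q with
  | Top => Eq c r
  | Bot => Bot
  | Eq d _ => if d == c then Bot else Eq d r
  end.

Lemma imset_permC (p : {perm 'I_4}) (A : {set 'I_4}) : p @: (~: A) = ~: (p @: A).
Proof.
by apply/setP => x; rewrite -(permKV p x) inE !(mem_imset _ _ perm_inj) inE.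
Qed.

Lemma face_glue_corner c s r q : on_face (tf s) q ->
  face_glue c s r @: corner_set q = corner_set (up_corner c r q).
Proof.
rewrite /corner_set imset_permC imsetU1 imset_set1 => q_s; congr (~: _).
case: q q_s => [_||d b] /=.
- case: s; first by rewrite (face_glue_tfN c true) face_glue_tf.
  by rewrite (face_glue_tfN c false) face_glue_tf setUC.
- by rewrite /on_face !face_eqs.
rewrite /on_face !face_eqs orbF => /eqP->; rewrite face_glue_tf.
have {2}-> : b = (b (+) d) (+) d by rewrite addbK.
rewrite face_glue_bf; case: (d == c) => /=; last by rewrite setUC.
by case: r; rewrite //= setUC.
Qed.

(** * Triangulations from coloured gluings *)

(** [up (t, s)] is the pair of the tetrahedron above the top face [s] of [t] and
    of the number of this face among the bottom faces there. *)
Record gluing (n : nat) := Gluing {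
  top_color : 'I_n -> bool;
  bottom_color : 'I_n -> bool;
  up : 'I_n * bool -> 'I_n * bool;
  down : 'I_n * bool -> 'I_n * bool;
  upK : cancel up down;
  downK : cancel down up;
  up_color : forall x, bottom_color (up x).1 = top_color x.1
}.

Section Gluing.
Variables (n : nat) (G : gluing n).
Implicit Types (t : 'I_n) (s r : bool) (i : 'I_4) (q : corner).

Definition side_nbr t i : 'I_n :=
  if is_top i then (up G (t, side i)).1 else (down G (t, side i)).1.

Definition side_glue t i : {perm 'I_4} :=
  if is_top i then face_glue (top_color G t) (side i) (up G (t, side i)).2
  else ((face_glue (bottom_color G t) (down G (t, side i)).2 (side i))^-1)%g.

(** Every side is a top side or the upper side of a top face, so that statements
    about sides need only be checked along [up]. *)
Variant side_spec : 'I_n -> 'I_4 -> Type :=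
  | TopSide t s : side_spec t (tf s)
  | BottomSide t s : side_spec (up G (t, s)).1 (bf (up G (t, s)).2).

Lemma sideP t i : side_spec t i.
Proof.
case/faceP: i => s; first exact: TopSide.
rewrite -[t]/(t, s).1 -[in bf _]/(t, s).2 -(downK G (t, s)).
by case: (down G (t, s)) => u r; apply: BottomSide.
Qed.

Lemma nbr_tf t s : side_nbr t (tf s) = (up G (t, s)).1.
Proof. by rewrite /side_nbr !sideE. Qed.

Lemma glue_tf t s :
  side_glue t (tf s) = face_glue (top_color G t) s (up G (t, s)).2.
Proof. by rewrite /side_glue !sideE. Qed.

Lemma nbr_bf t s : side_nbr (up G (t, s)).1 (bf (up G (t, s)).2) = t.
Proof. by rewrite /side_nbr !sideE -surjective_pairing upK. Qed.

Lemma glue_bf t s :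
  side_glue (up G (t, s)).1 (bf (up G (t, s)).2)
  = ((face_glue (top_color G t) s (up G (t, s)).2)^-1)%g.
Proof. by rewrite /side_glue !sideE -surjective_pairing upK up_color. Qed.

Lemma glue_tf_tf t s : side_glue t (tf s) (tf s) = bf (up G (t, s)).2.
Proof. by rewrite glue_tf face_glue_tf. Qed.

Lemma glue_bf_bf t s :
  side_glue (up G (t, s)).1 (bf (up G (t, s)).2) (bf (up G (t, s)).2) = tf s.
Proof. by rewrite glue_bf -(face_glue_tf (top_color G t) s) permK. Qed.

Definition side_glueE := (nbr_tf, nbr_bf, glue_tf_tf, glue_bf_bf, glue_tf, glue_bf).

Lemma side_nbrK t i : side_nbr (side_nbr t i) (side_glue t i i) = t.
Proof. by case: (sideP t i) => {t i} t s; rewrite !side_glueE. Qed.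

Lemma side_glueK t i :
  side_glue (side_nbr t i) (side_glue t i i) = ((side_glue t i)^-1)%g.
Proof. by case: (sideP t i) => {t i} t s; rewrite !side_glueE ?invgK. Qed.

Lemma side_glue_irrefl t i : (side_nbr t i, side_glue t i i) != (t, i).
Proof.
by case: (sideP t i) => {t i} t s; rewrite !side_glueE xpair_eqE face_eqs andbF.
Qed.

Lemma odd_side_glue t i : odd_perm (side_glue t i).
Proof.
by case: (sideP t i) => {t i} t s; rewrite !side_glueE ?odd_permV odd_face_glue.
Qed.

(** Likewise, passing from a corner to an adjacent one through a face is either an
    upward step or the reverse of one. *)
Variant crossing_spec :
    'I_n -> 'I_4 -> {set 'I_4} -> 'I_n -> {set 'I_4} -> Type :=
  | Upward t s q of on_face (tf s) q :
      crossing_spec t (tf s) (corner_set q) (up G (t, s)).1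
        (corner_set (up_corner (top_color G t) (up G (t, s)).2 q))
  | Downward t s q of on_face (tf s) q :
      crossing_spec (up G (t, s)).1 (bf (up G (t, s)).2)
        (corner_set (up_corner (top_color G t) (up G (t, s)).2 q))
        t (corner_set q).

Lemma crossingP t i (A : {set 'I_4}) : #|A| = 2%N -> i \notin A ->
  crossing_spec t i A (side_nbr t i) (side_glue t i @: A).
Proof.
move=> A2; case: (sideP t i) => {t i} t s iA; rewrite !side_glueE.
  rewrite -(set_cornerK A2) in iA *; rewrite in_corner_set in iA.
  by rewrite face_glue_corner //; apply: Upward.
set g := face_glue _ _ _.
have B2 : #|(g^-1)%g @: A| = 2%N by rewrite card_imset //; apply: perm_inj.
have sB : tf s \notin (g^-1)%g @: A.
  by rewrite -(permK g (tf s)) (mem_imset _ _ perm_inj) face_glue_tf.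
rewrite -(set_cornerK B2) in_corner_set in sB.
have -> : A = corner_set (up_corner (top_color G t) (up G (t, s)).2
                                     (set_corner ((g^-1)%g @: A))).
  rewrite -(face_glue_corner _ _ sB) (set_cornerK B2) -/g.
  by apply/setP => x; rewrite -[in RHS](permKV g x) !(mem_imset _ _ perm_inj).
rewrite -(face_glue_corner _ _ sB) -/g.
have -> : (g^-1)%g @: (g @: corner_set (set_corner ((g^-1)%g @: A)))
          = corner_set (set_corner ((g^-1)%g @: A)).
  by rewrite -imset_comp -[RHS]imset_id; apply: eq_imset => x /=; rewrite permK.
by rewrite (face_glue_corner _ _ sB); apply: Downward.
Qed.

End Gluing.

(** A rooted spanning tree of the dual graph: [parent t] is a side, in another
    tetrahedron, that leads to [t]. *)
Record connection n (G : gluing n) := Connection {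
  root : 'I_n;
  parent : 'I_n -> 'I_n * 'I_4;
  depth : 'I_n -> nat;
  parentP : forall t, t != root ->
    side_nbr G (parent t).1 (parent t).2 = t /\ (depth (parent t).1 < depth t)%N
}.

Section Connected.
Variables (n : nat) (G : gluing n) (C : connection G).

Lemma gluing_connected t u :
  connect [rel x y | [exists i, side_nbr G x i == y]] t u.
Proof.
set e := [rel x y | _].
have e_sym : connect_sym e.
  apply: sym_connect_sym => x y; apply/existsP/existsP => -[i /eqP<-];
  by exists (side_glue G x i i) + exists (side_glue G y i i); rewrite side_nbrK.
have from_root : forall t, connect e (root C) t.
  move=> {}t; have [m] := ubnP (depth C t).
  elim: m t => // m IHm t /ltnSE t_m.
  have [->|/(parentP (c := C))[tE lt_t]] := eqVneq t (root C).
    exact: connect0.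
  apply: connect_trans (IHm (parent C t).1 (leq_trans lt_t t_m)) (connect1 _).
  by apply/existsP; exists (parent C t).2; rewrite tE.
by apply: connect_trans (from_root u); rewrite e_sym.
Qed.

Definition gluing_triangulation : triangulation n :=
  Triangulation (side_nbrK G) (side_glueK G) (side_glue_irrefl G)
    (odd_side_glue G) gluing_connected.

End Connected.

(** * Edges, tautness and the veering condition *)

Section CornerStep.
Variables (n : nat) (V : triangulation n).

Lemma corner_step_sym : symmetric (corner_step V).
Proof.
suff imp x y : corner_step V x y -> corner_step V y x.
  by move=> x y; apply/idP/idP; apply: imp.
case/existsP => i /andP[ix /eqP->] /=; apply/existsP; exists (glue V x.1 i i).
rewrite (mem_imset _ _ perm_inj) ix glueK nbrK -imset_comp /=.
rewrite (eq_imset _ (g := id)) ?imset_id -?surjective_pairing //=.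
by move=> z /=; rewrite permK.
Qed.

Lemma corner_connect_sym : connect_sym (corner_step V).
Proof. exact: sym_connect_sym corner_step_sym. Qed.

End CornerStep.

(** Edges are numbered by the tetrahedron of which they are the top diagonal.  An
    equatorial edge of the colour of the bottom diagonal is the top diagonal of
    the tetrahedron immediately below, so only the label of the other equatorial
    edge on each bottom face, the far one, has to be given.  The fan of an edge
    has two sides, each a chain of far corners between a near corner and a bottom
    diagonal; [far_height] counts along this chain and excludes that it closes up
    without reaching a top diagonal. *)
Record edge_labelling n (G : gluing n) := EdgeLabelling {
  bot_label : 'I_n -> 'I_n;
  far_label : 'I_n -> bool -> 'I_n;
  far_height : 'I_n -> bool -> nat;
  eq_label t d s := if d == bottom_color G t then (down G (t, s)).1 else far_label t s;
  bot_label_inj : injective bot_label;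
  bot_label_up : forall t s,
    bot_label (up G (t, s)).1 = eq_label t (top_color G t) (s (+) top_color G t);
  far_label_up : forall t s, let: (t', s') := up G (t, s) in
    far_label t' s' = eq_label t (~~ top_color G t) (s (+) ~~ top_color G t);
  far_height_up : forall t s, bottom_color G t = top_color G t ->
    let: (t', s') := up G (t, s) in
    (far_height t (s (+) ~~ top_color G t) < far_height t' s')%N
}.

Section Veering.
Variables (n : nat) (G : gluing n) (C : connection G) (E : edge_labelling G).
Implicit Types (t : 'I_n) (s : bool) (i : 'I_4) (q : corner).
Implicit Types (x y z : 'I_n * {set 'I_4}).

Local Notation V := (gluing_triangulation C).

Definition label t q : 'I_n :=
  match q with
  | Top => t
  | Bot => bot_label E t
  | Eq d s => eq_label E t d s
  end.

Definition edge_of (x : 'I_n * {set 'I_4}) : 'I_n := label x.1 (set_corner x.2).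

Lemma edge_of_corner t q : edge_of (t, corner_set q) = label t q.
Proof. by rewrite /edge_of /= corner_setK. Qed.

Lemma label_up t s q : on_face (tf s) q ->
  label (up G (t, s)).1 (up_corner (top_color G t) (up G (t, s)).2 q) = label t q.
Proof.
case: q => [_||d b] /=; first 1 last.
- by rewrite /on_face !face_eqs.
- rewrite /on_face !face_eqs orbF => /eqP->.
  case: (eqVneq d (top_color G t)) => [->|neq] /=.
    by rewrite bot_label_up addbK.
  have -> : d = ~~ top_color G t by move: neq; case: d; case: top_color.
  rewrite /eq_label up_color; case: ifP => [/eqP|_]; first by case: top_color.
  have := far_label_up E t (b (+) ~~ top_color G t).
  by rewrite addbK; case: (up G _).
by rewrite /eq_label up_color eqxx -surjective_pairing upK.
Qed.

Lemma edge_of_step x y : #|x.2| = 2%N -> corner_step V x y ->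
  #|y.2| = 2%N /\ edge_of y = edge_of x.
Proof.
case: x => t A /= A2 /existsP[i /andP[iA /eqP->]] /=; split.
  by rewrite card_imset //; apply: perm_inj.
case: (crossingP G t A2 iA) => {t i iA A A2} t s q q_s;
  by rewrite !edge_of_corner label_up.
Qed.

Lemma edge_of_connect x y : #|x.2| = 2%N -> connect (corner_step V) x y ->
  #|y.2| = 2%N /\ edge_of y = edge_of x.
Proof.
move=> x2 /connectP[p]; elim: p x x2 => [|z p IHp] x x2 /=; first by move=> _ ->.
move=> /andP[xz zp] yE; have [z2 zE] := edge_of_step x2 xz.
by have [y2 ->] := IHp z z2 zp yE.
Qed.

Lemma corner_step_up t s q : on_face (tf s) q ->
  corner_step V ((up G (t, s)).1,
                 corner_set (up_corner (top_color G t) (up G (t, s)).2 q))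
    (t, corner_set q).
Proof.
move=> q_s; rewrite corner_step_sym; apply/existsP; exists (tf s).
by rewrite in_corner_set q_s /= !side_glueE face_glue_corner.
Qed.

(** Descending from an equatorial corner one meets far corners of decreasing
    height, then a near corner, which is a top diagonal one step below. *)
Lemma connect_eq t d s :
  connect (corner_step V) (t, corner_set (Eq d s)) (label t (Eq d s), corner_set Top).
Proof.
have near u r : connect (corner_step V)
    ((up G (u, r)).1, corner_set (Eq (top_color G u) (up G (u, r)).2)) (u, corner_set Top).
  apply: connect1; apply: (@corner_step_up u r Top).
  by rewrite /on_face /= !face_eqs; case: r.
have [m] := ubnP (far_height E t s); elim: m => // m IHm in t d s *.
move/ltnSE; have := downK G (t, s); case: (down G (t, s)) => u r ur t_m.
have tE : t = (up G (u, r)).1 by rewrite ur.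
have sE : s = (up G (u, r)).2 by rewrite ur.
have [->|neq] := eqVneq d (top_color G u).
  have cE : bottom_color G t = top_color G u by rewrite tE up_color.
  by have := near u r; rewrite ur /= /eq_label cE eqxx -ur upK.
have dE : d = ~~ top_color G u by move: neq; case: d; case: top_color.
have on_r : on_face (tf r) (Eq d (r (+) d)) by rewrite /on_face /= addbK eqxx.
have up_eq : up_corner (top_color G u) (up G (u, r)).2 (Eq d (r (+) d)) = Eq d s.
  by rewrite /= (negPf neq) -sE.
have := label_up u on_r; rewrite up_eq -tE => ->.
have step_tu := connect1 (corner_step_up u on_r); rewrite up_eq -tE in step_tu.
apply: connect_trans step_tu _.
have [d_u|d_u] := eqVneq d (bottom_color G u); last first.
  apply: IHm; apply: leq_trans t_m.
  have := @far_height_up _ _ E u r; rewrite ur -dE; apply.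
  by move: d_u neq; case: d {dE on_r up_eq}; case: bottom_color; case: top_color.
rewrite /= /eq_label -d_u eqxx.
have := downK G (u, r (+) d); case: (down G _) => w o wo /=.
have w_d : top_color G w = d by rewrite d_u -[w]/(w, o).1 -up_color wo.
by have := near w o; rewrite wo /= w_d.
Qed.

Lemma connect_label t q :
  connect (corner_step V) (t, corner_set q) (label t q, corner_set Top).
Proof.
case: q => [||d s]; [exact: connect0 | | exact: connect_eq].
have := downK G (t, false); case: (down G _) => u r ur.
pose q := Eq (top_color G u) (r (+) top_color G u).
have on_r : on_face (tf r) q by rewrite /on_face /= addbK eqxx.
have := label_up u on_r; rewrite ur /= eqxx /= => tE.
have := corner_step_up u on_r; rewrite ur /= eqxx => /connect1 t_u.
by apply: connect_trans t_u _; rewrite tE; apply: connect_eq.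
Qed.

(** An edge is a level set of the labelling: labels are invariant, and each corner
    is connected to the top diagonal of the tetrahedron named by its label. *)
Lemma mem_edge_class x y : #|x.2| = 2%N ->
  (y \in edge_class V x) = (#|y.2| == 2%N) && (edge_of y == edge_of x).
Proof.
have to_top z : #|z.2| = 2%N -> connect (corner_step V) z (edge_of z, corner_set Top).
  by case: z => t A /= A2; rewrite -{1}(set_cornerK A2); apply: connect_label.
move=> x2; rewrite inE; apply/idP/andP => [/(edge_of_connect x2)[-> ->]|] //.
case=> /eqP y2 /eqP yE; apply: connect_trans (to_top x x2) _.
by rewrite corner_connect_sym -yE; apply: to_top.
Qed.

Lemma edgesP (e : {set 'I_n * {set 'I_4}}) : e \in edges V ->
  exists a, forall y, (y \in e) = (#|y.2| == 2%N) && (edge_of y == a).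
Proof.
case/imsetP => x; rewrite inE => /eqP x2 ->; exists (edge_of x) => y.
exact: mem_edge_class.
Qed.

Definition gluing_out t i := is_top i.

Lemma gluing_out_mate t i :
  gluing_out (nbr V t i) (glue V t i i) = ~~ gluing_out t i.
Proof.
by rewrite /=; case: (sideP G t i) => {t i} t s; rewrite !side_glueE /gluing_out !sideE.
Qed.

Lemma corner_set_Bot : corner_set Bot = [set i | is_top i].
Proof.
by apply/setP => i; rewrite !inE; case/faceP: i => s; rewrite !face_eqs !sideE; case: s.
Qed.

Lemma corner_set_Top : corner_set Top = [set i | ~~ is_top i].
Proof.
by apply/setP => i; rewrite !inE; case/faceP: i => s; rewrite !face_eqs !sideE; case: s.
Qed.

Lemma gluing_two_out t : #|[set i | gluing_out t i]| = 2%N.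
Proof. by rewrite -corner_set_Bot card_corner_set. Qed.

Lemma all_top_faces q :
  [forall i, (i \notin corner_set q) ==> is_top i] = if q is Top then true else false.
Proof.
case: q => [||d s]; last 2 first.
- by apply/forallP => /(_ (bf false)); rewrite in_corner_set /on_face /= ?eqxx ?sideE.
- by apply/forallP => /(_ (bf s)); rewrite in_corner_set /on_face /= ?eqxx ?orbT ?sideE.
by apply/forallP => i; rewrite in_corner_set /on_face /=;
  case/faceP: i => r; rewrite sideE ?implybT ?face_eqs //; case: r.
Qed.

Lemma all_bottom_faces q :
  [forall i, (i \notin corner_set q) ==> ~~ is_top i] = if q is Bot then true else false.
Proof.
case: q => [||d s].
- by apply/forallP => /(_ (tf false)); rewrite in_corner_set /on_face /= ?eqxx ?sideE.
- apply/forallP => i; rewrite in_corner_set /on_face /=.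
  by case/faceP: i => r; rewrite sideE ?implybT ?face_eqs //; case: r.
by apply/forallP => /(_ (tf (s (+) d))); rewrite in_corner_set /on_face /= ?eqxx ?sideE.
Qed.

Lemma gluing_one_bottom e : e \in edges V ->
  #|[set x in e | [forall i, (i \notin x.2) ==> gluing_out x.1 i]]| = 1%N.
Proof.
case/edgesP => a eE; apply/eqP/cards1P; exists (a, corner_set Top).
apply/setP => -[t A]; rewrite !inE eE /=; apply/idP/eqP => [|[-> ->]].
  case/andP=> /andP[/eqP A2]; rewrite -(set_cornerK A2) edge_of_corner all_top_faces.
  by case: set_corner => //= /eqP->.
by rewrite card_corner_set edge_of_corner all_top_faces /= eqxx.
Qed.

(** The labels of the bottom diagonals are pairwise distinct, hence each label
    occurs. *)
Lemma gluing_one_top e : e \in edges V ->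
  #|[set x in e | [forall i, (i \notin x.2) ==> ~~ gluing_out x.1 i]]| = 1%N.
Proof.
case/edgesP => a eE; apply/eqP/cards1P.
exists (invF (@bot_label_inj _ _ E) a, corner_set Bot).
apply/setP => -[t A]; rewrite !inE eE /=; apply/idP/eqP => [|[-> ->]].
  case/andP=> /andP[/eqP A2]; rewrite -(set_cornerK A2) edge_of_corner all_bottom_faces.
  by case: set_corner => //= /eqP<-; rewrite invF_f.
by rewrite card_corner_set edge_of_corner all_bottom_faces /= f_invF eqxx.
Qed.

Definition gluing_taut : taut n :=
  Taut gluing_out_mate gluing_two_out gluing_one_bottom gluing_one_top.

Lemma large_edge_tf t s :
  large_edge gluing_taut t (tf s) = corner_set (Eq (top_color G t) (s (+) top_color G t)).
Proof.
set q := Eq _ _.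
have q_s : on_face (tf s) q by rewrite /on_face /= addbK eqxx.
rewrite /large_edge /= /gluing_out sideE /bottom_diagonal /= -corner_set_Bot.
rewrite side_glueE.
have <- : face_glue (top_color G t) s (up G (t, s)).2 @: corner_set q = corner_set Bot.
  by rewrite face_glue_corner //= eqxx.
by apply/setP => x; rewrite inE (mem_imset _ _ perm_inj).
Qed.

(** The large edges of the two top faces are the two equatorial edges of the
    colour of the top diagonal. *)
Lemma gluing_is_veering : is_veering gluing_taut.
Proof.
have corner_set_inj : injective corner_set := can_inj corner_setK.
have equat t d s : equatorial gluing_taut t (corner_set (Eq d s)).
  rewrite /equatorial card_corner_set /= /top_diagonal /bottom_diagonal /=.
  rewrite -corner_set_Bot -corner_set_Top.
  by apply/andP; split; apply/eqP => /corner_set_inj.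
move=> t i j /=; rewrite /gluing_out.
case/faceP: i => s; rewrite sideE // => _; case/faceP: j => r; rewrite sideE // => _.
rewrite face_eqs => neq_sr; rewrite !large_edge_tf; split=> //.
rewrite -setI_eq0; apply/eqP/setP => x; rewrite !inE.
case/faceP: x => b; rewrite !face_eqs ?orbF ?addbK /=;
  by move: neq_sr; case: s; case: r; case: b; case: (top_color G t).
Qed.

Definition gluing_veering : veering n := Veering gluing_is_veering.

End Veering.

(** * Holonomy around 2-cells *)

(** The number of turns [q] around the orbit need not be 1, which allows a closed
    walk around a 2-cell to be used without checking that it is injective. *)
Lemma sum_iter (T : finType) (f : T -> T) (W : zmodType) (F : T -> W) m x :
  injective f -> iter m f x = x ->
  exists q, \sum_(0 <= j < m) F (iter j f x)
            = (\sum_(y | fconnect f x y) F y) *+ q.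
Proof.
move=> f_inj; have [p] := ubnP m; elim: p m => // p IHp m /ltnSE m_p fx.
case: (posnP m) => [->|m_gt0]; first by exists 0%N; rewrite big_geq.
have o_gt0 : (0 < fingraph.order f x)%N := fingraph.order_gt0 f x.
have o_m : (fingraph.order f x <= m)%N.
  rewrite leqNgt; apply/negP => /findex_iter; rewrite fx => m0.
  by have := findex_iter o_gt0; rewrite /= m0 => m0'; rewrite m0' in m_gt0.
have [||q sum_q] := IHp (m - fingraph.order f x)%N.
- by apply: leq_trans m_p; rewrite ltn_subrL o_gt0.
- by rewrite -[X in iter _ _ X](iter_order f_inj) -iterD subnK.
exists q.+1; rewrite mulrS -sum_q (@big_cat_nat _ _ _ (fingraph.order f x)) //=; congr (_ + _).
  transitivity (\sum_(y <- fingraph.orbit f x) F y).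
    rewrite /fingraph.orbit (big_nth x) size_traject.
    by apply: eq_big_nat => j /andP[_ lt_j]; rewrite nth_traject.
  rewrite big_uniq ?orbit_uniq //; apply: eq_bigl => y.
  by rewrite -fconnect_orbit.
rewrite -{1}[fingraph.order f x]add0n big_addn; apply: eq_bigr => j _.
by rewrite iterD iter_order.
Qed.

Section Homology.
Variables (n : nat) (V : taut n).

Lemma homology_class_zmod : zmod_morphism (@homology_class n V).
Proof. by move=> y z; rewrite /homology_class !raddfB. Qed.

HB.instance Definition _ :=
  GRing.isZmodMorphism.Build _ _ (@homology_class n V) homology_class_zmod.

Lemma homology_class_bounds (z : cycle1 V) : z \in @bounds n V -> homology_class z = 0.
Proof.
move=> zb; rewrite /homology_class.
have -> : \pi_(Quotient.quot (@bounds n V)) z = 0.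
  by rewrite -(raddf0 \pi_(Quotient.quot (@bounds n V))); apply/eqP;
     rewrite -Quotient.idealrBE subr0.
by rewrite raddf0.
Qed.

Lemma Hfab_torsion_free (x : Hfab V) m : (0 < m)%N -> x *+ m = 0 -> x = 0.
Proof.
move=> m_gt0; elim/quotW: x => x.
rewrite -raddfMn -(raddf0 \pi_(Quotient.quot (@torsion n V))) => /eqP.
rewrite -Quotient.idealrBE subr0 => /asboolP[l l_gt0 xml].
apply/eqP; rewrite -Quotient.idealrBE subr0; apply/asboolP.
by exists (m * l)%N; rewrite ?muln_gt0 ?m_gt0 // mulrnA.
Qed.

(** The same corner with the other direction around it. *)
Definition reverse (x : 'I_n * 'I_4 * 'I_4) := (x.1.1, x.2, x.1.2).

(** Turning back after one turn and turning again undoes the first turn; in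
    particular [turn] is a bijection. *)
Lemma turn_reverse x : turn V (reverse (turn V x)) = reverse x.
Proof. by case: x => -[t i] j; rewrite /turn /reverse /= nbrK glueK !permK. Qed.

Lemma turn_inj : injective (turn V).
Proof.
move=> x y xy; have := turn_reverse x; rewrite xy turn_reverse.
by case: x {xy} => -[t i] j; case: y => -[u k] l [-> -> ->].
Qed.

Variable L : tet_lifts V.
Implicit Types x y z : 'I_n * 'I_4 * 'I_4.

Lemma holonomy_mate t i :
  holonomy L (nbr V t i) (glue V t i i) = - holonomy L t i.
Proof.
rewrite /holonomy -raddfN; congr homology_class; apply: val_inj => /=.
rewrite nbrK opprB -addrA; congr (_ + _); rewrite opprD [RHS]addrC; congr (_ - _).
apply/ffunP => f; rewrite !ffunE opprB; congr (_%:R - _%:R).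
by rewrite /mate /= nbrK glueK permK.
Qed.

(** The paths to the lifts telescope around a closed walk, and what remains is a
    multiple of the boundary of the 2-cell. *)
Lemma holonomy_loop m (x : 'I_n * 'I_4 * 'I_4) : x.1.2 != x.2 -> iter m (turn V) x = x ->
  \sum_(0 <= j < m) holonomy L (iter j (turn V) x).1.1 (iter j (turn V) x).1.2 = 0.
Proof.
move=> neq_x xm; rewrite /holonomy -raddf_sum; apply: homology_class_bounds.
rewrite unfold_in; apply/asboolP.
have [q sum_q] := sum_iter (fun y => step V y.1.1 y.1.2) turn_inj xm.
exists (fun y => if y == x then q%:Z else 0).
rewrite raddf_sum [RHS](bigD1 x) //= eqxx [X in _ = _ + X]big1 ?addr0; last first.
  by move=> y /andP[_ /negPf->]; rewrite mulr0z.
rewrite -pmulrn -sum_q.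
set y := fun j => iter j (turn V) x.
transitivity (\sum_(0 <= j < m) (step V (y j).1.1 (y j).1.2
                                 - (path L (y j.+1).1.1 - path L (y j).1.1))).
  apply: eq_bigr => j _; rewrite opprB addrCA addrA.
  by congr (_ - path L _); rewrite /y /=; case: (iter j _ x) => -[].
by rewrite sumrB telescope_sumr // /y xm subrr subr0.
Qed.

(** From the flag [x], turning around the 2-cell leads to the flag [y] through dual
    edges of total holonomy [w]. *)
Definition reaches x y (w : Hfab V) :=
  exists m, iter m (turn V) x = y /\
    \sum_(0 <= j < m) holonomy L (iter j (turn V) x).1.1 (iter j (turn V) x).1.2 = w.

Lemma reaches_refl x : reaches x x 0.
Proof. by exists 0%N; rewrite big_geq. Qed.

Lemma reaches_turn x : reaches x (turn V x) (holonomy L x.1.1 x.1.2).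
Proof. by exists 1%N; rewrite big_nat1. Qed.

Lemma reaches_trans x y z v w :
  reaches x y v -> reaches y z w -> reaches x z (v + w).
Proof.
move=> [p [xy <-]] [q [yz <-]]; exists (p + q)%N; split.
  by rewrite addnC iterD xy.
rewrite (@big_cat_nat _ _ _ p) ?leq_addr //=; congr (_ + _).
rewrite -{1}[p]add0n big_addn addKn; apply: eq_bigr => j _.
by rewrite iterD xy.
Qed.

Lemma reaches_reverse x y w :
  reaches x y w -> reaches (reverse y) (reverse x) (- w).
Proof.
move=> [m [<- <-]]; elim: m => [|m IHm].
  by rewrite big_geq // oppr0; apply: reaches_refl.
rewrite big_nat_recr //= opprD addrC; apply: reaches_trans IHm.
have := reaches_turn (reverse (turn V (iter m (turn V) x))).
rewrite turn_reverse; case: (iter m (turn V) x) => -[t i] j.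
by rewrite /turn /reverse /= holonomy_mate.
Qed.

Lemma reaches_loop x w : x.1.2 != x.2 -> reaches x x w -> w = 0.
Proof. by move=> neq_x [m [xm <-]]; apply: holonomy_loop. Qed.

(** The two ways around a 2-cell from one corner to another have the same
    holonomy. *)
Lemma reaches_unique x y v w : x.1.2 != x.2 ->
  reaches x y v -> reaches (reverse x) (reverse y) w -> v = w.
Proof.
move=> neq_x xy /reaches_reverse yx; apply/eqP; rewrite -subr_eq0; apply/eqP.
apply: (reaches_loop neq_x); apply: reaches_trans xy _.
have revK z : reverse (reverse z) = z by case: z => -[].
by rewrite !revK in yx.
Qed.

End Homology.

(** * Lifts along a spanning tree *)

Section TreeLifts.
Variables (n : nat) (V : taut n) (r : 'I_n) (parent : 'I_n -> 'I_n * 'I_4)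
  (depth : 'I_n -> nat).
Hypothesis parentP : forall t, t != r ->
  nbr V (parent t).1 (parent t).2 = t /\ (depth (parent t).1 < depth t)%N.

(** The chain carried by the path from the root to [t]; [m] is fuel that exceeds
    the depth of [t]. *)
Fixpoint tree_path (m : nat) (t : 'I_n) : chain1 V :=
  if m is m'.+1 then
    if t == r then 0
    else tree_path m' (parent t).1 + step V (parent t).1 (parent t).2
  else 0.

Lemma tree_path_stable m p t : (depth t < m)%N -> (m <= p)%N ->
  tree_path m t = tree_path p t.
Proof.
elim: m p t => // m IHm [//|p] t /ltnSE t_m /= mp; case: eqVneq => // t_r.
congr (_ + _); apply: IHm => //.
by have [_ lt_t] := parentP t_r; apply: leq_trans lt_t t_m.
Qed.

Lemma tree_boundary m t : (depth t < m)%N ->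
  boundary1 (tree_path m t) = vertex0 t - vertex0 r.
Proof.
elim: m t => // m IHm t /ltnSE t_m /=.
case: eqVneq => [->|t_r]; first by rewrite raddf0 subrr.
have [tE lt_t] := parentP t_r.
rewrite raddfD /= boundary1_step tE IHm ?(leq_trans lt_t) //.
by rewrite addrC subrKA.
Qed.

Lemma tree_lifts : exists L : tet_lifts V, forall t, t != r ->
  holonomy L (parent t).1 (parent t).2 = 0.
Proof.
exists (@TetLifts n V r (fun t => tree_path (depth t).+1 t)
          (fun t => tree_boundary (ltnSn _))) => t t_r.
rewrite /holonomy (_ : Cycle1 _ = 0) ?raddf0 //; apply: val_inj => /=.
have [tE lt_t] := parentP t_r.
rewrite tE /= (negPf t_r) -/(tree_path (depth (parent t).1).+1 (parent t).1).
by rewrite (tree_path_stable (ltnSn _) lt_t) subrr.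
Qed.

End TreeLifts.

(** * Vanishing of the maximal minors *)

Lemma gr_eltD (H : zmodType) (g h : H) : gr_elt (g + h) = gr_elt g * gr_elt h.
Proof. by rewrite [RHS]gr_mulUU mulr1. Qed.

Lemma gr_elt0 (H : zmodType) : gr_elt (0 : H) = 1.
Proof. by []. Qed.

Lemma mulr_rotate (R : comNzRingType) (w c a b : R) :
  w * (c * (a * b)) = b * (c * a * w).
Proof. by rewrite [RHS]mulrC [RHS]mulrAC [RHS]mulrC !mulrA. Qed.

(** The coefficient of an edge in the row relation is the common value of [u] on
    its corners; [u_face] is the equation at a bottom side of a face, before
    division by the lift of the face, which is a unit. *)
Section Vanishing.
Variables (n : nat) (V : veering n) (L : lifts V).
Variable u : 'I_n * {set 'I_4} -> group_ring (Hfab V).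
Implicit Types x y : 'I_n * {set 'I_4}.
Hypothesis u_step : forall x y, #|x.2| = 2%N -> corner_step V x y -> u y = u x.
Hypothesis u_face : forall t i, ~~ out V t i ->
  \sum_(A : {set 'I_4} | (#|A| == 2%N) && (i \notin A))
     (if A == large_edge V t i then 1 else - 1) * gr_elt (edge_lift L t A) * u (t, A) = 0.
Variable x1 : 'I_n * {set 'I_4}.
Hypothesis x1_corner : #|x1.2| = 2%N.
Hypothesis u_x1 : u x1 = 1.

Definition edge_weight (e : edge V) : group_ring (Hfab V) :=
  if [pick x in val e] is Some x then u x else 0.

Lemma edge_weightE (e : edge V) x : x \in val e -> edge_weight e = u x.
Proof.
have [e0] := imsetP (valP e); rewrite inE => /eqP e02 eE.
have u_e y : y \in val e -> u y = u e0.
  rewrite eE inE => /connectP[p]; elim: p e0 e02 {eE} => [|z p IHp] y0 y02 /=.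
    by move=> _ ->.
  move=> /andP[yz zp] yE; rewrite -(u_step y02 yz); apply: IHp zp yE.
  case/existsP: yz => i /andP[_ /eqP->] /=.
  by rewrite card_imset //; apply: perm_inj.
move=> x_e; rewrite /edge_weight; case: pickP => [y y_e|/(_ x)]; last by rewrite x_e.
by rewrite !u_e.
Qed.

Lemma edge_unique (x : 'I_n * {set 'I_4}) : #|x.2| = 2%N ->
  exists e : edge V, forall e' : edge V, (x \in val e') = (e' == e).
Proof.
move=> x2; have e_V : edge_class V x \in edges V.
  by apply/imsetP; exists x; rewrite ?inE ?x2.
exists (exist (fun e => e \in edges V) _ e_V) => e'.
rewrite -val_eqE /=; have [y] := imsetP (valP e'); rewrite inE => /eqP y2 ->.
rewrite inE; apply/idP/eqP => [yx|].
  apply/setP => z; rewrite !inE.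
  exact: (same_connect (corner_connect_sym V)).
by move/setP/(_ x); rewrite !inE connect0.
Qed.

Lemma weighted_column (f : face V) :
  \sum_(e : edge V) edge_weight e * taut_coef L e f = 0.
Proof.
rewrite /taut_coef; case: f => -[t i] /= ti.
pose F A := gr_elt (- face_lift L t i) *
  ((if A == large_edge V t i then 1 else - 1) * gr_elt (edge_lift L t A) * u (t, A)).
transitivity (\sum_(A : {set 'I_4} | (#|A| == 2%N) && (i \notin A)) F A); last first.
  by rewrite /F -big_distrr /= u_face ?mulr0.
transitivity (\sum_(e : edge V) \sum_(A : {set 'I_4} | (#|A| == 2%N) && (i \notin A))
                 if (t, A) \in val e then F A else 0).
  apply: eq_bigr => e _; rewrite big_distrr /= -big_mkcondr /=.
  apply: eq_big => [A|A /and3P[_ _ A_e]]; first by rewrite andbA.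
  rewrite (edge_weightE A_e) gr_eltD /F.
  exact: mulr_rotate.
rewrite exchange_big /=; apply: eq_bigr => A /andP[/eqP A2 _].
have [e eE] := @edge_unique (t, A) A2.
rewrite (bigD1 e) //= eE eqxx big1 ?addr0 // => e' /negPf e'_e.
by rewrite eE e'_e.
Qed.

(** A row relation [m *m M = 0] gives [\det M *: m = 0], and [m] has an entry 1. *)
Lemma vanishing_minor (g : 'I_#|edge V| -> 'I_#|face V|) : maximal_minor L g = 0.
Proof.
rewrite /maximal_minor; set M := colsub g _.
pose m : 'rV[group_ring (Hfab V)]_#|edge V| := \row_a edge_weight (enum_val a).
have mM : m *m M = 0.
  apply/rowP => b; rewrite !mxE.
  rewrite -[RHS](weighted_column (enum_val (g b))).
  rewrite (reindex _ (onW_bij _ (@enum_val_bij (edge V)))) /=.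
  by apply: eq_bigr => a _; rewrite !mxE.
have [e eE] := edge_unique x1_corner.
have := congr1 (fun N => (N *m \adj M) 0 (enum_rank e)) mM.
rewrite /= -mulmxA mul_mx_adj mul_mx_scalar mul0mx !mxE enum_rankK.
by rewrite (@edge_weightE e x1) ?eE // u_x1 mulr1.
Qed.

Lemma vanishing_taut_polynomial : is_taut_polynomial V 0.
Proof.
exists L; split=> [g _|d _]; first by exists 0; rewrite vanishing_minor mulr0.
by exists 0; rewrite mul0r.
Qed.

End Vanishing.

(** * Fans of edges *)

Section Fans.
Variables (n : nat) (G : gluing n) (C : connection G) (E : edge_labelling G).
Local Notation V := (gluing_veering C E).
Variable L : tet_lifts V.

Definition hol t s : Hfab V := holonomy L t (tf s).

(** Flags pointing upwards: the top diagonal of [t], left through the top face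
    [s]; an equatorial corner; the bottom diagonal of [t], entered through the
    bottom face [s]. *)
Definition top_flag (t : 'I_n) s : 'I_n * 'I_4 * 'I_4 := (t, tf s, tf (~~ s)).
Definition eq_flag (t : 'I_n) c b : 'I_n * 'I_4 * 'I_4 := (t, tf (b (+) c), bf b).
Definition bot_flag (t : 'I_n) s : 'I_n * 'I_4 * 'I_4 := (t, bf (~~ s), bf s).

Lemma turn_tf t s j :
  turn V (t, tf s, j) = ((up G (t, s)).1, face_glue (top_color G t) s (up G (t, s)).2 j,
                         bf (up G (t, s)).2).
Proof. by rewrite /turn /= !side_glueE face_glue_tf. Qed.

Lemma reaches_top t s u r y w : up G (t, s) = (u, r) ->
  reaches L (eq_flag u (top_color G t) r) y w ->
  reaches L (top_flag t s) y (hol t s + w).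
Proof.
move=> tu; apply: reaches_trans; have := reaches_turn L (top_flag t s).
by rewrite {2}/top_flag turn_tf tu face_glue_tfN.
Qed.

Lemma reaches_eq t c b u r y w : up G (t, b (+) c) = (u, r) -> c != top_color G t ->
  reaches L (eq_flag u c r) y w ->
  reaches L (eq_flag t c b) y (hol t (b (+) c) + w).
Proof.
move=> tu neq_c; apply: reaches_trans; have := reaches_turn L (eq_flag t c b).
rewrite {2}/eq_flag turn_tf tu /=.
by rewrite -[X in face_glue _ _ _ (bf X)](addbK c b) face_glue_bf (negPf neq_c).
Qed.

Lemma reaches_bot t c b u r : up G (t, b (+) c) = (u, r) -> c == top_color G t ->
  reaches L (eq_flag t c b) (bot_flag u r) (hol t (b (+) c)).
Proof.
move=> tu eq_c; have := reaches_turn L (eq_flag t c b).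
rewrite {2}/eq_flag turn_tf tu /=.
by rewrite -[X in face_glue _ _ _ (bf X)](addbK c b) face_glue_bf eq_c.
Qed.

(** The relation of a 2-cell: its left and right sides climb from the same top
    diagonal to the same bottom diagonal, which they enter from opposite sides. *)
Lemma fan_relation t u r v w :
  reaches L (top_flag t false) (bot_flag u r) v ->
  reaches L (top_flag t true) (bot_flag u (~~ r)) w -> v = w.
Proof.
rewrite /bot_flag negbK => tu tw.
by apply: (reaches_unique _ tu tw).
Qed.

End Fans.

(** * The triangulations

    Tetrahedra are natural numbers below [8 + k]; the chain is formed by [8 + i]
    for [i < k]. *)

Definition top_red (m : nat) : bool := m \in [:: 0; 4; 6]%N.
Definition bottom_red (m : nat) : bool := m \in [:: 0; 1; 2]%N.

(** The chain runs from the tetrahedron 2 through the second top faces up to its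
    last tetrahedron, which is glued to itself, and back through the first top
    faces down to the tetrahedron 6.  Apart from this, the table does not depend
    on [k]. *)
Definition up_tet (k m : nat) (s : bool) : nat * bool :=
  match m, s with
  | 0, false => (1, false)
  | 0, true => (2, false)
  | 1, false => (3, false)
  | 1, true => (4, false)
  | 2, false => (5, false)
  | 2, true => (if k is 0 then 6 else 8, false)
  | 3, false => (4, true)
  | 3, true => (7, false)
  | 4, false => (1, true)
  | 4, true => (0, true)
  | 5, false => (6, true)
  | 5, true => (7, true)
  | 6, false => (2, true)
  | 6, true => (0, false)
  | 7, false => (5, true)
  | 7, true => (3, true)
  | i.+4.+4, false => if i is j.+1 then (8 + j, true) else (6, false)
  | i.+4.+4, true => if i.+1 < k then (9 + i, false) else (8 + i, true)
  end%N.

Definition down_tet (k m : nat) (s : bool) : nat * bool :=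
  match m, s with
  | 0, false => (6, true)
  | 0, true => (4, true)
  | 1, false => (0, false)
  | 1, true => (4, false)
  | 2, false => (0, true)
  | 2, true => (6, false)
  | 3, false => (1, false)
  | 3, true => (7, true)
  | 4, false => (1, true)
  | 4, true => (3, false)
  | 5, false => (2, false)
  | 5, true => (7, false)
  | 6, false => if k is 0 then (2, true) else (8, false)
  | 6, true => (5, false)
  | 7, false => (3, true)
  | 7, true => (5, true)
  | i.+4.+4, false => if i is j.+1 then (8 + j, true) else (2, true)
  | i.+4.+4, true => if i.+1 < k then (9 + i, false) else (8 + i, true)
  end%N.

(** The tetrahedron 6 is reached downwards from 2, since the way upwards from 2
    leads into the chain. *)
Definition parent_tet (m : nat) : nat * 'I_4 :=
  match m with
  | 0 => (0, tf false)
  | 1 => (0, tf false)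
  | 2 => (0, tf true)
  | 3 => (1, tf false)
  | 4 => (1, tf true)
  | 5 => (2, tf false)
  | 6 => (2, bf true)
  | 7 => (3, tf true)
  | 8 => (2, tf true)
  | i.+1 => (i, tf true)
  end%N.

(** The edge that is the bottom diagonal of [m]. *)
Definition bot_edge (m : nat) : nat :=
  if (m < 8)%N then nth 0 [:: 0; 4; 6; 5; 1; 3; 2; 7]%N m else m.

(** The far corners of the chain, which are red, all belong to the edge 0, the only
    edge whose degree grows with [k]. *)
Definition far_edge (k m : nat) (s : bool) : nat :=
  match m, s with
  | 0, false => 5
  | 0, true => 3
  | 1, false => 5
  | 1, true => 1
  | 2, false => 3
  | 2, true => if k is 0 then 2 else 8
  | 3, _ => 4
  | 4, false => 0
  | 4, true => 4
  | 5, _ => 6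
  | 6, false => 0
  | 6, true => 6
  | 7, false => 4
  | 7, true => 6
  | _, _ => 0
  end%N.

Definition eq_edge k m d s : nat :=
  if d == bottom_red m then (down_tet k m s).1 else far_edge k m s.

(** The number of upward steps from the top diagonal; along the edge 0 it grows by
    one in each tetrahedron of the chain, first on the way up and then on the way
    back. *)
Definition height_tet (k m : nat) (s : bool) : nat :=
  match m, s with
  | 0, _ => 2
  | 1, false => 3
  | 1, true => 2
  | 2, false => 3
  | 2, true => 2
  | 3, false => 2
  | 3, true => 4
  | 4, false => 2
  | 4, true => 5
  | 5, false => 2
  | 5, true => 4
  | 6, false => k.*2.+2
  | 6, true => 5
  | 7, _ => 3
  | i.+4.+4, false => i.+2
  | i.+4.+4, true => k.*2.+1 - i
  end%N.

Ltac tet_cases m :=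
  case: m => [|[|[|[|[|[|[|[|m]]]]]]]].

Lemma up_tet_lt k m s : (m < 8 + k)%N -> ((up_tet k m s).1 < 8 + k)%N.
Proof.
tet_cases m; case: s => //= lt_m; try by case: k lt_m.
- by case: ifP => /=; lia.
- by case: m lt_m => //= m; lia.
Qed.

Lemma down_tet_lt k m s : (m < 8 + k)%N -> ((down_tet k m s).1 < 8 + k)%N.
Proof.
tet_cases m; case: s => //= lt_m; try by case: k lt_m.
- by case: ifP => /=; lia.
- by case: m lt_m => //= m; lia.
Qed.

Lemma up_tetK k m s : (m < 8 + k)%N ->
  down_tet k (up_tet k m s).1 (up_tet k m s).2 = (m, s).
Proof.
tet_cases m; case: s => //= lt_m; try by case: k lt_m.
- by case: ifP => //= ->.
- case: m lt_m => [|m] //= lt_m; first by case: k lt_m.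
  by rewrite ifT //; lia.
Qed.

Lemma up_tet_red k m s : (m < 8 + k)%N -> bottom_red (up_tet k m s).1 = top_red m.
Proof.
tet_cases m; case: s => //= lt_m; try by case: k lt_m.
- by case: ifP.
- by case: m lt_m.
Qed.

Lemma bot_edge_lt k m : (m < 8 + k)%N -> (bot_edge m < 8 + k)%N.
Proof. by tet_cases m. Qed.

Lemma bot_edge_inj : injective bot_edge.
Proof. by move=> m p; tet_cases m; tet_cases p. Qed.

Lemma far_edge_lt k m s : (far_edge k m s < 8 + k)%N.
Proof. by tet_cases m; case: s => //; case: k. Qed.

Lemma bot_edge_up k m s : (m < 8 + k)%N ->
  bot_edge (up_tet k m s).1 = eq_edge k m (top_red m) (s (+) top_red m).
Proof.
tet_cases m; case: s => //= lt_m; try by case: k lt_m.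
- by rewrite /eq_edge /=; case: ifP.
- by case: m lt_m.
Qed.

Lemma far_edge_up k m s : (m < 8 + k)%N ->
  far_edge k (up_tet k m s).1 (up_tet k m s).2
  = eq_edge k m (~~ top_red m) (s (+) ~~ top_red m).
Proof.
tet_cases m; case: s => //= lt_m; try by case: k lt_m.
- by case: ifP.
- by case: m lt_m.
Qed.

Lemma height_up k m s : (m < 8 + k)%N -> bottom_red m = top_red m ->
  (height_tet k m (s (+) ~~ top_red m)
   < height_tet k (up_tet k m s).1 (up_tet k m s).2)%N.
Proof.
tet_cases m; case: s => //= lt_m _; try by case: k lt_m.
- by case: ifP => /=; lia.
- by case: m lt_m => //= m; lia.
Qed.

Definition side_tet k m i : nat :=
  if is_top i then (up_tet k m (side i)).1 else (down_tet k m (side i)).1.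

Lemma parent_tet_lt m : m != 0%N -> ((parent_tet m).1 < m)%N.
Proof. by tet_cases m => //; case: m. Qed.

Lemma side_tet_parent k m : m != 0%N -> (m < 8 + k)%N ->
  side_tet k (parent_tet m).1 (parent_tet m).2 = m.
Proof.
tet_cases m => // _; case: m => [|m]; first by case: k.
by rewrite /side_tet /= => lt_m; rewrite ifT //; lia.
Qed.

Section FamilyTriangulation.
Variable k : nat.

Definition tet (m : nat) : 'I_(8 + k) := @inord (7 + k) m.

Lemma tetK m : (m < 8 + k)%N -> tet m = m :> nat.
Proof. exact: inordK. Qed.

Lemma tet_val (t : 'I_(8 + k)) : tet t = t.
Proof. exact: inord_val. Qed.

Definition fam_up (x : 'I_(8 + k) * bool) : 'I_(8 + k) * bool :=
  (tet (up_tet k x.1 x.2).1, (up_tet k x.1 x.2).2).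
Definition fam_down (x : 'I_(8 + k) * bool) : 'I_(8 + k) * bool :=
  (tet (down_tet k x.1 x.2).1, (down_tet k x.1 x.2).2).

Lemma fam_upK : cancel fam_up fam_down.
Proof.
move=> [t s]; rewrite /fam_down /= tetK ?up_tet_lt //=.
by rewrite up_tetK //= tet_val.
Qed.

Lemma fam_downK : cancel fam_down fam_up.
Proof. exact: canF_sym fam_upK. Qed.

Lemma fam_up_color x : bottom_red (fam_up x).1 = top_red x.1.
Proof. by rewrite /= tetK ?up_tet_lt // up_tet_red. Qed.

Definition fam_gluing : gluing (8 + k) :=
  @Gluing (8 + k) (fun t => top_red t) (fun t => bottom_red t)
    fam_up fam_down fam_upK fam_downK fam_up_color.

Lemma fam_parentP (t : 'I_(8 + k)) : t != tet 0 ->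
  side_nbr fam_gluing (tet (parent_tet t).1) (parent_tet t).2 = t
  /\ (tet (parent_tet t).1 < t)%N.
Proof.
rewrite -(inj_eq val_inj) /= tetK // => t0.
have lt_p := parent_tet_lt t0; have p_lt := ltn_trans lt_p (ltn_ord t).
rewrite tetK //; split=> //; apply: val_inj.
rewrite -[RHS](side_tet_parent t0 (ltn_ord t)) /side_nbr /side_tet.
by case: is_top; rewrite /= !tetK // ?up_tet_lt ?down_tet_lt.
Qed.

Definition fam_connection : connection fam_gluing :=
  @Connection _ fam_gluing (tet 0) (fun t => (tet (parent_tet t).1, (parent_tet t).2))
    val fam_parentP.


Definition fam_edge_labelling : edge_labelling fam_gluing.
Proof.
apply: (@EdgeLabelling _ fam_gluing (fun t => tet (bot_edge t))
  (fun t s => tet (far_edge k t s)) (fun t s => height_tet k t s)).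
- move=> t u /(congr1 val); rewrite /= !tetK ?bot_edge_lt //.
  by move/bot_edge_inj/val_inj.
- move=> t s; rewrite /= tetK ?up_tet_lt // bot_edge_up // /eq_edge.
  by case: ifP.
- move=> t s /=; rewrite tetK ?up_tet_lt // far_edge_up // /eq_edge.
  by case: ifP.
- by move=> t s /= /height_up; rewrite tetK ?up_tet_lt //; apply.
Defined.

Local Notation V := (gluing_veering fam_connection fam_edge_labelling).

Lemma fam_tree_lifts : exists L : tet_lifts V, forall t : 'I_(8 + k), t != tet 0 ->
  holonomy L (tet (parent_tet t).1) (parent_tet t).2 = 0.
Proof.
exact: (@tree_lifts _ V (tet 0) (fun t => (tet (parent_tet t).1, (parent_tet t).2))
          val fam_parentP).
Qed.

End FamilyTriangulation.

(** * The first homology *)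

(** The relations of the 2-cells after those variables that vanish on the tree or
    coincide have been eliminated: [a] and [g] are the classes of the two top
    faces of the tetrahedron 4, [f7] and [b] those of 7, [p] and [t5] those of 5,
    and [q] is that of the second top face of 6.  All unknowns are expressed by
    [b] and [a]; the last relation then reads [(2k + 6) a = 0]. *)
Lemma holonomy_system (W : zmodType) (k : nat) (a b g p q y f7 t5 : W) :
  (forall (x : W) m, (0 < m)%N -> x *+ m = 0 -> x = 0) ->
  a + (b + (a + a)) = g -> a + g = f7 -> f7 + t5 = b -> p + q = t5 + b ->
  t5 + (f7 + p) = q -> p = y *+ 2 -> g = y *+ k.*2.+1 + q ->
  [/\ a = 0, b = g, f7 = g & t5 = 0] /\ [/\ p = 0, q = g & y = 0].
Proof.
move=> W_tf eg e7 e5 epq eq ep egy.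
have g_b : g = b + a *+ 3.
  by rewrite -eg addrCA -mulr2n -mulrS.
have f7_b : f7 = b + a *+ 4 by rewrite -e7 g_b addrCA -mulrS.
have t5_a : t5 = - (a *+ 4).
  by apply: (addrI f7); rewrite e5 f7_b addrK.
have q_b : q = b + p.
  by rewrite -eq t5_a f7_b [b + _]addrC -addrA addKr.
have pp : p + p = - (a *+ 4).
  by apply: (addrI b); rewrite addrCA -q_b epq t5_a addrC.
have p_a : p = - (a *+ 2).
  apply/eqP; rewrite -addr_eq0; apply/eqP; apply: (W_tf _ 2%N) => //.
  by rewrite mulrnDl -mulrnA mulr2n pp addNr.
have y_a : y = - a.
  apply/eqP; rewrite -addr_eq0; apply/eqP; apply: (W_tf _ 2%N) => //.
  by rewrite mulrnDl -ep p_a addNr.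
have a0 : a = 0.
  apply: (W_tf _ (k.*2 + 6)%N); first by rewrite addnS.
  move: egy; rewrite g_b q_b y_a p_a mulNrn [_ + (b - _)]addrCA => /addrI /eqP.
  rewrite -opprD -mulrnDr -addr_eq0 -mulrnDr => /eqP <-.
  by congr (_ *+ _); lia.
have p0 : p = 0 by rewrite p_a a0 mul0rn oppr0.
have gb : g = b by rewrite g_b a0 mul0rn addr0.
rewrite q_b f7_b t5_a y_a p0 gb a0 mul0rn !addr0 oppr0.
by split; split.
Qed.

Section FamilyHolonomy.
Variable k : nat.
Local Notation V := (gluing_veering (fam_connection k) (fam_edge_labelling k)).
Variable L : tet_lifts V.
Hypothesis tree : forall t : 'I_(8 + k), t != tet k 0 ->
  holonomy L (tet k (parent_tet t).1) (parent_tet t).2 = 0.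

Definition tet_hol (m : nat) (s : bool) : Hfab V := hol L (tet k m) s.

Local Notation climbs m c b p r w :=
  (reaches L (eq_flag (tet k m) c b) (bot_flag (tet k p) r) w).
Local Notation fan m s p r w :=
  (reaches L (top_flag (tet k m) s) (bot_flag (tet k p) r) w).

Lemma tree_nat m : m != 0%N -> (m < 8 + k)%N ->
  holonomy L (tet k (parent_tet m).1) (parent_tet m).2 = 0.
Proof.
move=> m0 m_lt; rewrite -{1 2}(tetK m_lt); apply: tree.
by rewrite -(inj_eq val_inj) /= !tetK.
Qed.

Lemma gluing_up m s p r : (m < 8 + k)%N -> up_tet k m s = (p, r) ->
  up (fam_gluing k) (tet k m, s) = (tet k p, r).
Proof. by move=> m_lt ms; rewrite /= /fam_up /= tetK // ms. Qed.

Lemma fan_start m s u b p r w : up_tet k m s = (u, b) -> (m < 8 + k)%N ->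
  climbs u (top_red m) b p r w -> fan m s p r (tet_hol m s + w).
Proof.
move=> /gluing_up up_m m_lt; rewrite -{1}(tetK m_lt).
exact: reaches_top (up_m m_lt).
Qed.

Lemma climb_through m c b u d p r w : up_tet k m (b (+) c) = (u, d) ->
  (m < 8 + k)%N -> c != top_red m ->
  climbs u c d p r w -> climbs m c b p r (tet_hol m (b (+) c) + w).
Proof.
move=> /gluing_up up_m m_lt; rewrite -{1}(tetK m_lt).
exact: reaches_eq (up_m m_lt).
Qed.

Lemma climb_end m c b p r : up_tet k m (b (+) c) = (p, r) ->
  (m < 8 + k)%N -> c == top_red m -> climbs m c b p r (tet_hol m (b (+) c)).
Proof.
move=> /gluing_up up_m m_lt; rewrite -{1}(tetK m_lt).
exact: reaches_bot (up_m m_lt).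
Qed.

(** The fans of the edges 1 and 3 to 7 do not meet the chain and can be followed
    step by step. *)
Ltac climb := first
  [ by apply: climb_end
  | apply: climb_through; [by [] | by [] | by [] | climb] ].
Ltac trace_fan := apply: fan_start; [by [] | by [] | climb].

Lemma fan_nat m p r v w : fan m false p r v -> fan m true p (~~ r) w -> v = w.
Proof. exact: fan_relation. Qed.

Lemma edge1 :
  tet_hol 1 false + tet_hol 3 false = tet_hol 1 true + (tet_hol 4 false + tet_hol 1 true).
Proof. by apply: (@fan_nat 1 4 true); trace_fan. Qed.

Lemma edge3 :
  tet_hol 3 false + (tet_hol 4 true + (tet_hol 0 true + tet_hol 2 false))
  = tet_hol 3 true + tet_hol 7 false.
Proof. by apply: (@fan_nat 3 5 false); trace_fan. Qed.

Lemma edge4 :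
  tet_hol 4 false + (tet_hol 1 false + (tet_hol 3 true
    + (tet_hol 7 true + (tet_hol 3 false + tet_hol 4 false))))
  = tet_hol 4 true + tet_hol 0 false.
Proof. by apply: (@fan_nat 4 1 true); trace_fan. Qed.

Lemma edge5 :
  tet_hol 5 false + (tet_hol 6 true + (tet_hol 0 false + tet_hol 1 false))
  = tet_hol 5 true + tet_hol 7 true.
Proof. by apply: (@fan_nat 5 3 false); trace_fan. Qed.

Lemma edge6 :
  tet_hol 6 false + (tet_hol 2 false + (tet_hol 5 true
    + (tet_hol 7 false + (tet_hol 5 false + tet_hol 6 false))))
  = tet_hol 6 true + tet_hol 0 true.
Proof. by apply: (@fan_nat 6 2 true); trace_fan. Qed.

Lemma edge7 : tet_hol 7 false + tet_hol 5 true = tet_hol 7 true + tet_hol 3 true.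
Proof. by apply: (@fan_nat 7 7 true); trace_fan. Qed.

Lemma tree_up m p s : (m < 8 + k)%N -> m != 0%N -> parent_tet m = (p, tf s) -> tet_hol p s = 0.
Proof. by move=> m_lt m0 mp; have := tree_nat m0 m_lt; rewrite mp. Qed.

Lemma tet_hol_tree :
  [/\ tet_hol 0 false = 0, tet_hol 0 true = 0, tet_hol 1 false = 0 & tet_hol 1 true = 0]
  /\ [/\ tet_hol 2 false = 0, tet_hol 3 true = 0 & tet_hol 6 false = 0].
Proof.
split; split.
- exact: (@tree_up 1).
- exact: (@tree_up 2).
- exact: (@tree_up 3).
- exact: (@tree_up 4).
- exact: (@tree_up 5).
- exact: (@tree_up 7).
have := @tree_nat 6 isT isT => /=.
have := holonomy_mate L (tet k 6) (tf false).
have -> : nbr V (tet k 6) (tf false) = tet k 2.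
  by rewrite [LHS]nbr_tf (gluing_up _ (erefl (up_tet k 6 false))).
have -> : glue V (tet k 6) (tf false) (tf false) = bf true.
  by rewrite [LHS]glue_tf_tf (gluing_up _ (erefl (up_tet k 6 false))).
by move=> -> /eqP; rewrite oppr_eq0 => /eqP.
Qed.

Lemma tet_hol_chain_up i : (i.+1 < k)%N -> tet_hol (8 + i) true = 0.
Proof. by move=> i_lt; apply: (@tree_up (9 + i)); first by lia. Qed.

Lemma tet_hol_2_true : (0 < k)%N -> tet_hol 2 true = 0.
Proof. by move=> k0; apply: (@tree_up 8); first by lia. Qed.

(** In the fan of the edge [8 + i] only one dual edge on the first side lies
    outside the tree. *)
Lemma chain_fan_false i : (i < k)%N ->
  fan (8 + i) false (8 + i) false (tet_hol (8 + i) false).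
Proof.
have [_ [h2 _ h6]] := tet_hol_tree; case: i => [|i] i_lt.
  rewrite -[tet_hol _ _]addr0 -[X in _ + X]addr0 -[X in _ + (X + _)]h6.
  rewrite -[X in _ + (_ + X)](tet_hol_2_true i_lt).
  apply: fan_start => //.
  apply: climb_through => //; apply: climb_end => //=.
  by case: k i_lt.
rewrite -[tet_hol _ _]addr0 -[X in _ + X](tet_hol_chain_up i_lt).
apply: fan_start => //.
apply: climb_end => //=; last by lia.
by rewrite i_lt.
Qed.

Lemma chain_fan i : (i < k)%N ->
  tet_hol (8 + i) false
  = if (i.+1 < k)%N then tet_hol (9 + i) false else tet_hol (8 + i) true *+ 2.
Proof.
move=> i_lt; apply: (fan_nat (chain_fan_false i_lt)).
have i_lt' : (8 + i < 8 + k)%N by lia.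
case: ifP => i_k.
  rewrite -[tet_hol (9 + i) _]add0r -[X in X + _](tet_hol_chain_up i_k).
  apply: fan_start => //=; first by rewrite i_k.
  by apply: climb_end => //=; lia.
rewrite mulr2n; apply: fan_start => //=; first by rewrite i_k.
by apply: climb_end => //=; rewrite i_k.
Qed.

(** Hence the dual edges leading back through the chain all have twice the holonomy
    of the loop at its end. *)
Lemma chain_down i : (i < k)%N -> tet_hol (8 + i) false = tet_hol (7 + k) true *+ 2.
Proof.
have [d] := ubnP (k - i); elim: d i => // d IHd i d_lt i_lt.
rewrite chain_fan //; case: ifP => i_k; first by apply: (IHd i.+1); lia.
by congr (tet_hol _ true *+ 2); lia.
Qed.

(** The second side of the edge 0 crosses the chain twice; it is followed from its
    end, first along the way back. *)
Lemma climb_chain_down i : (i < k)%N ->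
  climbs (8 + i) true true 0 false (tet_hol (7 + k) true *+ i.+1.*2 + tet_hol 6 true).
Proof.
elim: i => [|i IHi] i_lt.
  rewrite -(chain_down i_lt); apply: climb_through => //.
  exact: climb_end.
rewrite (_ : i.+2.*2 = 2 + i.+1.*2)%N // mulrnDr -(chain_down i_lt) -addrA.
apply: climb_through => //.
by apply: IHi; lia.
Qed.

Lemma climb_chain_up i : (i < k)%N ->
  climbs (8 + i) true false 0 false (tet_hol (7 + k) true *+ k.*2.+1 + tet_hol 6 true).
Proof.
have [d] := ubnP (k - i); elim: d i => // d IHd i d_lt i_lt.
have i_lt' : (8 + i < 8 + k)%N by lia.
have [i_k|k_i] := ltnP i.+1 k.
  rewrite -[X in reaches _ _ _ X]add0r -[X in X + (_ + _)](tet_hol_chain_up i_k).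
  apply: climb_through => //=; first by rewrite i_k.
  by apply: (IHd i.+1); lia.
have k_eq : (7 + k = 8 + i)%N by lia.
rewrite mulrS -addrA [X in tet_hol X _ + _]k_eq.
apply: climb_through => //=; first by rewrite ifN // -leqNgt.
have := climb_chain_down i_lt.
by rewrite (_ : i.+1 = k) //; lia.
Qed.

(** The two edges whose fans meet the tetrahedron 2 through the face replaced by
    the chain.  For [k = 0] the class [y] is that of this face, and otherwise that
    of the loop at the end of the chain; the two relations are the same in terms
    of [y]. *)
Lemma edges02 : exists y, [/\ tet_hol 5 false = y *+ 2,
  tet_hol 4 true = y *+ k.*2.+1 + tet_hol 6 true &
  y = 0 -> tet_hol 2 true = 0 /\ forall i s, (i < k)%N -> tet_hol (8 + i) s = 0].
Proof.
have [[h0f h0t h1f h1t] [h2f h3t h6f]] := tet_hol_tree.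
have left0 : fan 0 false 0 true (tet_hol 4 true).
  rewrite -[tet_hol 4 true]add0r -[X in X + _]h0f -[X in _ + X]add0r -[X in _ + (X + _)]h1t.
  by trace_fan.
have left2 : fan 2 false 6 true (tet_hol 5 false).
  by rewrite -[tet_hol 5 false]add0r -[X in X + _]h2f; trace_fan.
have [k0|k_gt0] := posnP k.
  have up2 : up_tet k 2 true = (6%N, false) by rewrite /= k0.
  exists (tet_hol 2 true); split.
  - apply: (fan_nat left2); rewrite mulr2n -[X in _ + X]add0r -[X in _ + (X + _)]h6f.
    apply: (fan_start up2) => //; apply: climb_through => //.
    exact: (@climb_end 2 false true).
  - apply: (fan_nat left0); rewrite (_ : k.*2.+1 = 1)%N ?k0 // mulr1n.
    rewrite -[X in reaches _ _ _ X]add0r -[X in X + (_ + _)]h0t.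
    apply: fan_start => //; apply: (@climb_through 2 true false _ _ _ _ _ up2) => //.
    exact: climb_end.
  by move=> y0; split=> // i s; rewrite [in (_ < _)%N]k0.
have up2 : up_tet k 2 true = (8%N, false) by case: (k) k_gt0.
exists (tet_hol (7 + k) true); split.
- apply: (fan_nat left2); rewrite -(chain_down k_gt0) -[tet_hol (8 + 0) _]add0r.
  rewrite -[X in X + _](tet_hol_2_true k_gt0).
  by apply: (fan_start up2) => //; apply: climb_end => //; lia.
- apply: (fan_nat left0); rewrite -[X in reaches _ _ _ X]add0r -[X in X + (_ + _)]h0t.
  apply: fan_start => //; rewrite -[X in reaches _ _ _ X]add0r.
  rewrite -[X in X + (_ + _)](tet_hol_2_true k_gt0).
  apply: (@climb_through 2 true false _ _ _ _ _ up2) => //.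
  exact: (climb_chain_up k_gt0).
move=> y0; split=> [|i [] i_lt]; first exact: tet_hol_2_true.
  have [/tet_hol_chain_up//|k_i] := ltnP i.+1 k.
  by rewrite -y0; congr (tet_hol _ true); lia.
by rewrite chain_down // y0 mul0rn.
Qed.

(** The top faces of class [g]; the others have class 0. *)
Definition crosses (m : nat) (s : bool) : bool :=
  if s then m \in [:: 4; 6; 7]%N else m == 7%N.

Lemma tet_hol_crosses m s : (m < 8 + k)%N -> tet_hol m s = tet_hol 4 true *+ crosses m s.
Proof.
have [[h0f h0t h1f h1t] [h2f h3t h6f]] := tet_hol_tree.
have [y [e2 e0 y0_chain]] := edges02.
have := edge1; rewrite h1f h1t add0r addr0 add0r => e1.
have := edge4; rewrite h1f h3t h0f !add0r addr0 e1 => e4.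
have := edge3; rewrite h0t h2f h3t addr0 addr0 add0r e1 => e3.
have := edge7; rewrite h3t addr0 => e7.
have := edge5; rewrite h0f h1f !addr0 => e5.
have := edge6; rewrite h6f h2f h0t !addr0 !add0r => e6.
have := holonomy_system (@Hfab_torsion_free _ V) e4 e3 e7 e5 e6 e2 e0.
case=> [[h4f h7t h7f h5t] [h5f h6t /y0_chain[h2t hchain]]].
rewrite h4f in e1.
tet_cases m; case: s; rewrite ?mulr1n ?mulr0n //.
- by move=> m_lt; rewrite -[m.+4.+4]/(8 + m)%N hchain.
- by move=> m_lt; rewrite -[m.+4.+4]/(8 + m)%N hchain.
Qed.

End FamilyHolonomy.

(** * Weights *)

Lemma sum_bottom_corners (W : zmodType) s (F : {set 'I_4} -> W) :
  \sum_(A : {set 'I_4} | (#|A| == 2%N) && (bf s \notin A)) F A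
  = F (corner_set Bot) + (F (corner_set (Eq true s)) + F (corner_set (Eq false s))).
Proof.
have set_inj := can_inj corner_setK.
rewrite (bigD1 (corner_set Bot)) /=; last first.
  by rewrite card_corner_set in_corner_set /on_face /=; case: s.
rewrite (bigD1 (corner_set (Eq true s))) /=; last first.
  rewrite card_corner_set in_corner_set /on_face /= eqxx orbT /=.
  by apply/eqP => /set_inj.
rewrite (bigD1 (corner_set (Eq false s))) /=; last first.
  rewrite card_corner_set in_corner_set /on_face /= eqxx orbT /=.
  by apply/andP; split; apply/eqP => /set_inj.
rewrite big1 ?addr0 // => A /andP[/andP[/andP[/andP[/eqP A2]]]].
rewrite -(set_cornerK A2) in_corner_set; case: set_corner => [||d b].
- by rewrite /on_face /= !face_eqs.
- by rewrite eqxx.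
rewrite /on_face /= !face_eqs => /eqP->.
by case: d; rewrite eqxx ?andbF.
Qed.

Lemma gr_eltMn (A : zmodType) (g : A) m : gr_elt (g *+ m) = gr_elt g ^+ m.
Proof.
by elim: m => [|m IHm]; rewrite ?mulr0n ?gr_elt0 ?expr0 // mulrS gr_eltD IHm exprS.
Qed.

(** A corner whose position is [p] lies on the translate by [p] times [g] of the
    chosen lift of its edge.  The lifts are chosen so that bottom diagonals have
    position 0; the values on top diagonals and on far corners are then forced by
    [crosses], and those on near corners are computed from the top diagonal
    below. *)
Definition top_pos (m : nat) : bool := (m == 0) || (2 < m < 8)%N.

Definition far_pos (m : nat) (s : bool) : bool := (6 < m)%N || (2 < m)%N && ~~ s.

Definition pos k m (q : corner) : nat :=
  match q with
  | Top => top_pos m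
  | Bot => 0
  | Eq d s =>
      if d == bottom_red m
      then top_pos (down_tet k m s).1 - crosses (down_tet k m s).1 (down_tet k m s).2
      else far_pos m s
  end%N.

Lemma pos_up k m s q : (m < 8 + k)%N -> on_face (tf s) q ->
  pos k m q
  = (crosses m s + pos k (up_tet k m s).1 (up_corner (top_red m) (up_tet k m s).2 q))%N.
Proof.
move=> m_lt; case: q => [_||d b]; rewrite /on_face /= ?face_eqs //.
  by rewrite up_tet_red // eqxx up_tetK //=; move: m_lt; tet_cases m; case: s.
rewrite orbF => /eqP->; move: m_lt.
tet_cases m; case: d; case: b => //= m_lt; try by case: k m_lt.
all: try by case: (m.+1 < k)%N.
all: by case: m m_lt.
Qed.

(** The weight of the chosen lift of the edge numbered [m], [X] being the element
    [g] of the group ring. *)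
Definition weight (R : comNzRingType) (X : R) (m : nat) : R :=
  match m with
  | 0%N | 7%N => 0
  | 1%N => X - 1
  | 3%N | 6%N => 1
  | 4%N | 5%N => - 1
  | _ => 1 - X
  end.

(** The equation at the bottom face [s] of [m]. *)
Lemma weight_face (R : comNzRingType) (X : R) k m s : (m < 8 + k)%N ->
  weight X (bot_edge m)
  = weight X (eq_edge k m true s) * X ^+ pos k m (Eq true s)
    + weight X (eq_edge k m false s) * X ^+ pos k m (Eq false s).
Proof.
have XX : 1 = X + (1 - X) by rewrite addrC subrK.
tet_cases m; case: s => //= m_lt.
all: try by case: k m_lt => [|k] _; rewrite /= ?expr0 ?expr1 ?mulr1 ?mul1r ?mul0r ?add0r ?addr0.
all: rewrite ?expr0 ?expr1 ?mulr1 ?mul0r ?mul1r ?add0r ?addr0 ?subrr ?mulN1r //.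
- by rewrite addNr.
- by rewrite addKr.
- by rewrite addKr.
- by rewrite addrC.
- by rewrite subrr.
- by rewrite addNr.
- by rewrite /eq_edge /=; case: ifP => _; rewrite expr0 mulr1.
- by case: m m_lt => [|m] _; rewrite expr0 mulr1.
Qed.

Section FamilyWeights.
Variable k : nat.
Local Notation V := (gluing_veering (fam_connection k) (fam_edge_labelling k)).
Variable L : tet_lifts V.
Hypothesis tree : forall t : 'I_(8 + k), t != tet k 0 ->
  holonomy L (tet k (parent_tet t).1) (parent_tet t).2 = 0.

Local Notation g := (tet_hol L 4 true).

Lemma hol_crosses (t : 'I_(8 + k)) s : holonomy L t (tf s) = g *+ crosses t s.
Proof. by rewrite -(tet_hol_crosses tree) // /tet_hol tet_val. Qed.

Definition fam_face_lift (t : 'I_(8 + k)) (i : 'I_4) : Hfab V :=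
  if is_top i then holonomy L t i else 0.

Definition fam_edge_lift (t : 'I_(8 + k)) (A : {set 'I_4}) : Hfab V :=
  g *+ pos k t (set_corner A).

Lemma fam_face_lift_glue t i :
  fam_face_lift t i = holonomy L t i + fam_face_lift (nbr V t i) (glue V t i i).
Proof.
have mate_top : is_top (glue V t i i) = ~~ is_top i := out_mate V t i.
rewrite /fam_face_lift mate_top; case: (is_top i) => /=; first by rewrite addr0.
by rewrite (holonomy_mate L) subrr.
Qed.

Lemma fam_edge_lift_glue t i (A : {set 'I_4}) : #|A| = 2%N -> i \notin A ->
  fam_edge_lift t A = holonomy L t i + fam_edge_lift (nbr V t i) (glue V t i @: A).
Proof.
rewrite /fam_edge_lift => A2 iA.
have step_up (t' : 'I_(8 + k)) s q : on_face (tf s) q ->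
    g *+ pos k t' q = holonomy L t' (tf s)
      + g *+ pos k (up (fam_gluing k) (t', s)).1
          (up_corner (top_color (fam_gluing k) t') (up (fam_gluing k) (t', s)).2 q).
  move=> q_s; rewrite hol_crosses -mulrnDr /= tetK ?up_tet_lt //.
  by rewrite -pos_up.
have hol_down t' s : holonomy L (up (fam_gluing k) (t', s)).1
      (bf (up (fam_gluing k) (t', s)).2) = - holonomy L t' (tf s).
  have := holonomy_mate L t' (tf s).
  have -> : nbr V t' (tf s) = (up (fam_gluing k) (t', s)).1 by apply: nbr_tf.
  by have -> : glue V t' (tf s) (tf s) = bf (up (fam_gluing k) (t', s)).2 by apply: glue_tf_tf.
rewrite -[nbr V t i]/(side_nbr (fam_gluing k) t i).
rewrite -[glue V t i]/(side_glue (fam_gluing k) t i).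
case: (crossingP (fam_gluing k) t A2 iA) => {t i A A2 iA} t s q q_s; rewrite !corner_setK.
  exact: step_up.
by rewrite hol_down (step_up _ _ _ q_s) addKr.
Qed.

Definition fam_lifts : lifts V := Lifts fam_face_lift_glue fam_edge_lift_glue.

Definition fam_weight (x : 'I_(8 + k) * {set 'I_4}) : group_ring (Hfab V) :=
  weight (gr_elt g) (edge_of (fam_edge_labelling k) x).

Lemma fam_weight_step (x y : 'I_(8 + k) * {set 'I_4}) :
  #|x.2| = 2%N -> corner_step V x y -> fam_weight y = fam_weight x.
Proof. by move=> x2 xy; rewrite /fam_weight (edge_of_step (fam_edge_labelling k) x2 xy).2. Qed.

Lemma eq_label_nat (t : 'I_(8 + k)) d s :
  eq_label (fam_edge_labelling k) t d s = eq_edge k t d s :> nat.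
Proof.
by rewrite /eq_label /eq_edge /=; case: ifP => _; rewrite tetK ?down_tet_lt ?far_edge_lt.
Qed.

Lemma fam_weight_face t i : ~~ out V t i ->
  \sum_(A : {set 'I_4} | (#|A| == 2%N) && (i \notin A))
     (if A == large_edge V t i then 1 else - 1)
       * gr_elt (edge_lift fam_lifts t A) * fam_weight (t, A) = 0.
Proof.
case/faceP: i => s; rewrite /= /gluing_out sideE // => _.
rewrite sum_bottom_corners /large_edge /= /gluing_out sideE /bottom_diagonal /=.
have neq_Bot d : (corner_set (Eq d s) == corner_set Bot) = false.
  by apply/negbTE/eqP => /(can_inj corner_setK).
rewrite -corner_set_Bot eqxx !neq_Bot /fam_edge_lift !corner_setK !gr_eltMn.
rewrite /fam_weight !edge_of_corner /label !eq_label_nat /= tetK ?bot_edge_lt //.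
rewrite (weight_face _ s (ltn_ord t)) !mulN1r !mul1r !mulNr.
by rewrite ![weight _ _ * _]mulrC -opprD subrr.
Qed.

Lemma fam_vanishing : is_taut_polynomial V 0.
Proof.
apply: (vanishing_taut_polynomial (L := fam_lifts) fam_weight_step fam_weight_face
  (x1 := (tet k 3, corner_set Top))); first exact: card_corner_set.
by rewrite /fam_weight edge_of_corner /= tetK.
Qed.

End FamilyWeights.

Theorem mainTheorem1 (k : nat) :
  exists V : veering (8 + k)%N, is_taut_polynomial V 0.
Proof.
have [L tree] := fam_tree_lifts k.
exists (gluing_veering (fam_connection k) (fam_edge_labelling k)).
by apply: fam_vanishing tree.
Qed.
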